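(* Let $E$ be an exact Courant algebroid over a smooth manifold $M$ (with anchor $\pi$, pairing $\langle\cdot,\cdot\rangle$ and bracket $[\cdot,\cdot]$), and let $C_+\subset E$ be a generalized metric, i.e. a maximal positive-definite subbundle, with $C_-=C_+^{\perp}$ and associated positive-definite metric $G$ on $E$. Let $C:E\to E$ be the associated map $C(X+\xi)=X-\xi$ defined in the context. For $Z\in C^\infty(E)$ write $Z=Z_++Z_-$ for its orthogonal projections to $C_\pm$ (and likewise use subscripts $\pm$ for the projection of any section). Then the operator $$D_Z(W)=[Z_-,W_+]_+ + [Z_+,W_-]_- + [CZ_-,W_-]_- + [CZ_+,W_+]_+$$ defines a generalized connection on $E$, preserving both $\langle\cdot,\cdot\rangle$ and the positive-definite metric $G$.
   Context: $T,T^*$ denote the tangent and cotangent bundles of $M$. An (exact) Courant algebroid is an extension of real vector bundles $0\to T^*\xrightarrow{\pi^*}E\xrightarrow{\pi}T\to0$ with a nondegenerate symmetric bilinear form $\langle\cdot,\cdot\rangle$ of split signature such that $\langle\pi^*\xi,a\rangle=\xi(\pi(a))$, and a bilinear bracket on $C^\infty(E)$ satisfying: $[[a,b],c]=[a,[b,c]]-[b,[a,c]]$; $[a,fb]=f[a,b]+(\pi(a)f)b$; $\pi(a)\langle b,c\rangle=\langle[a,b],c\rangle+\langle b,[a,c]\rangle$; $[a,a]=\tfrac12\pi^*d\langle a,a\rangle$. A generalized connection on a vector bundle $V$ is a first-order linear differential operator $D:C^\infty(V)\to C^\infty(E\otimes V)$ with $D(fs)=fDs+(\pi^*df)\otimes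 s$. Contracting with $Z\in C^\infty(E)$ using $\langle\cdot,\cdot\rangle$ gives $D_Z s$, so $D_{fZ}s=fD_Zs$ and $D_Z(fs)=fD_Zs+(\pi(Z)f)s$. $D$ preserves a bilinear form $\beta$ on $V$ if $\pi(Z)\beta(s,t)=\beta(D_Zs,t)+\beta(s,D_Zt)$. A generalized (Riemannian) metric is a maximal positive-definite subbundle $C_+\subset E$; with $C_-=C_+^\perp$ (orthogonal complement for $\langle\cdot,\cdot\rangle$), $G=\langle\cdot,\cdot\rangle|_{C_+}-\langle\cdot,\cdot\rangle|_{C_-}$ is a positive-definite metric on $E$. The $G$-orthogonal complement of $T^*$ in $E$ is isotropic and is identified with $T$ via $\pi$; this gives a splitting $E=T\oplus T^*$, and $C:E\to E$ is defined by $C(X+\xi)=X-\xi$ in this splitting; it satisfies $C(C_\pm)=C_\mp$. *)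

(* Defs.v *)
From HB Require Import structures.
From mathcomp Require Import all_boot all_order all_algebra.
From mathcomp Require Import all_classical all_reals all_analysis.
Import numFieldNormedType.Exports.
Import Order.TTheory GRing.Theory Num.Theory.

Set Implicit Arguments.
Unset Strict Implicit.
Unset Printing Implicit Defensive.

Local Open Scope classical_set_scope.
Local Open Scope ring_scope.

(* [ndiff k U f]: f is k times (Frechet) differentiable on the open set U.
   For all k together this is the usual C^oo: every iterated partial derivative
   exists and is continuous on U. *)
Fixpoint ndiff (R : realType) (n k : nat) (U : set 'rV[R]_n)
    (f : 'rV[R]_n -> R^o) : Prop :=
  if k is k'.+1 then
    (forall x, U x -> differentiable f x) /\
    (forall i : 'I_n, ndiff k' U (fun x => 'D_(delta_mx ord0 i) f x))
  else True.

Definition smooth_Rn (R : realType) (n : nat) (U : set 'rV[R]_n)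
    (f : 'rV[R]_n -> R^o) : Prop := forall k, ndiff k U f.

(* A smooth n-manifold, given by a smooth atlas.  The charts and their inverses
   are total functions, only meaningful on [chart_dom i], resp. on
   [chart i @` chart_dom i]; [chart_at x] is a preferred chart around x. *)
Record smoothManifold (R : realType) (n : nat) := SmoothManifold {
  carrier :> topologicalType;
  carrier_hausdorff : hausdorff_space carrier;
  carrier_second_countable : @second_countable carrier;
  chart_idx : Type;
  chart_dom : chart_idx -> set carrier;
  chart : chart_idx -> carrier -> 'rV[R]_n;
  chart_inv : chart_idx -> 'rV[R]_n -> carrier;
  chart_at : carrier -> chart_idx;
  chart_atP : forall x, chart_dom (chart_at x) x;
  chart_dom_open : forall i, open (chart_dom i);
  chart_img_open : forall i, open (chart i @` chart_dom i);
  chartK : forall i x, chart_dom i x -> chart_inv i (chart i x) = x;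
  chart_continuous : forall i x, chart_dom i x -> {for x, continuous (chart i)};
  chart_inv_continuous : forall i x, chart_dom i x ->
    {for chart i x, continuous (chart_inv i)};
  chart_smooth : forall i j (k : 'I_n),
    smooth_Rn (chart i @` (chart_dom i `&` chart_dom j))
      (fun u => chart j (chart_inv i u) ord0 k)
}.

Section SmoothFunctions.
Variables (R : realType) (n : nat) (M : smoothManifold R n).

(* Smoothness on the open subset U of M. *)
Definition smooth_on (U : set M) (f : M -> R) : Prop :=
  forall i : chart_idx M,
    smooth_Rn (@chart _ _ M i @` (chart_dom i `&` U)) (f \o chart_inv i).

Definition smooth_fun (f : M -> R) : Prop := smooth_on setT f.

(* The fibre T_x M is R^n, read in the preferred chart [chart_at x]. *)
Definition differential (f : M -> R) (x : M) : 'Hom('rV[R]_n, R^o) :=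
  linfun ('d (f \o chart_inv (chart_at x) : 'rV[R]_n -> R^o)
             (chart (chart_at x) x)).

Definition coord_vect (i : chart_idx M) (k : 'I_n) (x : M) : 'rV[R]_n :=
  'd (@chart _ _ M (chart_at x) \o chart_inv i) (chart i x) (delta_mx ord0 k).

Definition coord_form (i : chart_idx M) (k : 'I_n) (x : M) :
    'Hom('rV[R]_n, R^o) :=
  differential (fun y => chart i y ord0 k) x.

End SmoothFunctions.

(* A family of vector spaces over M with local frames ([frame a x] is only
   meaningful for x in [frame_dom a]).  The frames play the role of the local
   trivialisations; [is_vector_bundle] says that they define a vector bundle. *)
Record framedFamily (R : realType) (n : nat) (M : smoothManifold R n) :=
  FramedFamily {
  fibre :> M -> vectType R;
  frame_idx : Type;
  frame_dom : frame_idx -> set M;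
  frame_rank : frame_idx -> nat;
  frame : forall (a : frame_idx) (x : M), (frame_rank a).-tuple (fibre x)
}.

Notation section V := (forall x, fibre V x).

Section Bundles.
Variables (R : realType) (n : nat) (M : smoothManifold R n).
Implicit Types V W : framedFamily M.

Definition smooth_section_on V (U : set M) (s : section V) : Prop :=
  forall (a : frame_idx V) (i : 'I_(frame_rank a)),
    smooth_on (frame_dom a `&` U) (fun x => coord (frame a x) i (s x)).

Definition smooth_section V (s : section V) : Prop := smooth_section_on setT s.

Definition is_vector_bundle V : Prop :=
  [/\ forall a : frame_idx V, open (frame_dom a),
      forall x, exists a : frame_idx V, frame_dom a x,
      forall (a : frame_idx V) x, frame_dom a x -> basis_of fullv (frame a x) &
      forall (a : frame_idx V) (i : 'I_(frame_rank a)),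
        smooth_section_on (frame_dom a) (fun x => tnth (frame a x) i)].

Definition smooth_hom V W (F : forall x, 'Hom(V x, W x)) : Prop :=
  forall (a : frame_idx V) (i : 'I_(frame_rank a)),
    smooth_section_on (frame_dom a) (fun x => F x (tnth (frame a x) i)).

Definition smooth_form V (b : forall x, V x -> V x -> R) : Prop :=
  forall (a : frame_idx V) (i j : 'I_(frame_rank a)),
    smooth_on (frame_dom a)
      (fun x => b x (tnth (frame a x) i) (tnth (frame a x) j)).

Definition is_subbundle V (C : forall x, {vspace V x}) : Prop :=
  forall x, exists (U : set M) (r : nat) (e : forall y, r.-tuple (V y)),
    [/\ open U, U x, forall y, U y -> basis_of (C y) (e y) &
        forall i : 'I_r, smooth_section_on U (fun y => tnth (e y) i)].

Definition tangent : framedFamily M :=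
  @FramedFamily R n M (fun=> 'rV[R]_n : vectType R)
    (chart_idx M) (@chart_dom _ _ M) (fun=> n)
    (fun i x => [tuple coord_vect i k x | k < n]).

Definition cotangent : framedFamily M :=
  @FramedFamily R n M (fun=> 'Hom('rV[R]_n, R^o) : vectType R)
    (chart_idx M) (@chart_dom _ _ M) (fun=> n)
    (fun i x => [tuple coord_form i k x | k < n]).

(* In finite dimension, A (x) B is the space of linear maps from the dual of A
   to B, the pure tensor a (x) b being alpha |-> alpha(a) b. *)
Definition tensor_space (A B : vectType R) : vectType R :=
  'Hom('Hom(A, R^o), B).

Definition pure_tensor (A B : vectType R) (a : A) (b : B) : tensor_space A B :=
  linfun (fun alpha : 'Hom(A, R^o) => (alpha a : R) *: b).

Definition tensor_bundle V W : framedFamily M :=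
  @FramedFamily R n M (fun x => tensor_space (V x) (W x))
    (frame_idx V * frame_idx W)%type
    (fun ab => frame_dom ab.1 `&` frame_dom ab.2)
    (fun ab => frame_rank ab.1 * frame_rank ab.2)%N
    (fun ab x =>
       allpairs_tuple (@pure_tensor (V x) (W x)) (frame ab.1 x) (frame ab.2 x)).

End Bundles.

Section Forms.
Variables (R : realType) (V : vectType R).
Implicit Types (b : V -> V -> R) (U : {vspace V}).

Definition posdef_on b U : Prop := forall v, v \in U -> v != 0 -> 0 < b v v.

Definition negdef_on b U : Prop := forall v, v \in U -> v != 0 -> b v v < 0.

Definition nondegenerate_form b : Prop :=
  forall u, (forall v, b u v = 0) -> u = 0.

Definition split_signature b : Prop :=
  exists P N : {vspace V}, [/\ (P + N)%VS = fullv, \dim P = \dim N,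
    posdef_on b P & negdef_on b N].

Definition maximal_posdef b U : Prop :=
  posdef_on b U /\
  forall U' : {vspace V}, posdef_on b U' -> (U <= U')%VS -> U' = U.

Definition orthogonal_complement b U : {vspace V} :=
  (\bigcap_(i < \dim U) lker (linfun (b (tnth (vbasis U) i) : V -> R^o)))%VS.

Lemma orthogonal_complementP (b : {biscalar V}) U v :
  v \in orthogonal_complement b U <-> (forall u, u \in U -> b u v = 0).
Proof.
have capP (I : finType) (F : I -> {vspace V}) :
    v \in (\bigcap_i F i)%VS <-> forall i, v \in F i.
  by rewrite memvE; split=> [/subv_bigcapP h i | h];
    [rewrite memvE; apply: h | apply/subv_bigcapP => i _; rewrite -memvE].
rewrite capP; split=> [h u /coord_vbasis -> | h i].
  rewrite linear_sumlz /= big1 // => i _; rewrite linearZl_LR /=.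
  by have := h i; rewrite memv_ker lfunE /= (tnth_nth 0) => /eqP ->; rewrite mulr0.
by rewrite memv_ker lfunE /= h // vbasis_mem // mem_tnth.
Qed.

End Forms.

Section Courant.
Variables (R : realType) (n : nat) (M : smoothManifold R n).
Variable E : framedFamily M.

(* The bracket is an operation on smooth sections; it is represented by a
   function on all sections, whose values on non-smooth ones are arbitrary. *)
Record exactCourant := ExactCourant {
  anchor : forall x, 'Hom(E x, tangent M x);
  coanchor : forall x, 'Hom(cotangent M x, E x);
  pairing : forall x, {biscalar (E x)};
  bracket : section E -> section E -> section E;

  courant_bundle : is_vector_bundle E;

  anchor_smooth : smooth_hom anchor;
  coanchor_smooth : smooth_hom coanchor;
  coanchor_inj : forall x, lker (coanchor x) = 0%VS;
  courant_exact : forall x, limg (coanchor x) = lker (anchor x);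
  anchor_surj : forall x, limg (anchor x) = fullv;

  pairing_smooth : smooth_form (fun x => pairing x);
  pairing_sym : forall x a b, pairing x a b = pairing x b a;
  pairing_nondegenerate : forall x, nondegenerate_form (pairing x);
  pairing_split : forall x, split_signature (pairing x);
  pairing_coanchor : forall x (xi : cotangent M x) (a : E x),
    pairing x (coanchor x xi) a = xi (anchor x a);

  bracket_smooth : forall a b : section E,
    smooth_section a -> smooth_section b -> smooth_section (bracket a b);
  bracket_linearl : forall (k : R) (a b c : section E),
    smooth_section a -> smooth_section b -> smooth_section c ->
    forall x, bracket (fun y => k *: a y + b y) c x
              = k *: bracket a c x + bracket b c x;
  bracket_linearr : forall (k : R) (a b c : section E),
    smooth_section a -> smooth_section b -> smooth_section c ->
    forall x, bracket a (fun y => k *: b y + c y) x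
              = k *: bracket a b x + bracket a c x;
  bracket_jacobi : forall a b c : section E,
    smooth_section a -> smooth_section b -> smooth_section c ->
    forall x, bracket (bracket a b) c x
              = bracket a (bracket b c) x - bracket b (bracket a c) x;
  bracket_leibniz : forall (f : M -> R) (a b : section E),
    smooth_fun f -> smooth_section a -> smooth_section b ->
    forall x, bracket a (fun y => f y *: b y) x
              = f x *: bracket a b x + (differential f x (anchor x (a x)) : R) *: b x;
  bracket_pairing : forall a b c : section E,
    smooth_section a -> smooth_section b -> smooth_section c ->
    forall x, differential (fun y => pairing y (b y) (c y)) x (anchor x (a x))
              = pairing x (bracket a b x) (c x) + pairing x (b x) (bracket a c x);
  bracket_diag : forall a : section E, smooth_section a ->
    forall x, bracket a a x
              = 2^-1 *: coanchor x (differential (fun y => pairing y (a y) (a y)) x)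
}.

Variable A : exactCourant.

Definition generalized_connection (V : framedFamily M)
    (D : section V -> section (tensor_bundle E V)) : Prop :=
  [/\ forall s, smooth_section s -> smooth_section (D s),
      forall (k : R) (s t : section V), smooth_section s -> smooth_section t ->
        forall x, D (fun y => k *: s y + t y) x = k *: D s x + D t x,
      (* first-order differential operator, in the sense [[D, f], g] = 0 *)
      forall (f g : M -> R) (s : section V),
        smooth_fun f -> smooth_fun g -> smooth_section s ->
        forall x, D (fun y => f y *: (g y *: s y)) x - f x *: D (fun y => g y *: s y) x
                  - g x *: (D (fun y => f y *: s y) x - f x *: D s x) = 0 &
      forall (f : M -> R) (s : section V), smooth_fun f -> smooth_section s ->
        forall x, D (fun y => f y *: s y) x
                  = f x *: D s x
                    + pure_tensor (coanchor A x (differential f x)) (s x)].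

Definition conn_contraction (V : framedFamily M) (Z : section E)
    (t : section (tensor_bundle E V)) : section V :=
  fun x => (t x : 'Hom('Hom(E x, R^o), V x))
             (linfun (pairing A x (Z x) : E x -> R^o)).

Definition preserves (V : framedFamily M)
    (D : section V -> section (tensor_bundle E V))
    (beta : forall x, V x -> V x -> R) : Prop :=
  forall (Z : section E) (s t : section V),
    smooth_section Z -> smooth_section s -> smooth_section t ->
    forall x, differential (fun y => beta y (s y) (t y)) x (anchor A x (Z x))
              = beta x (conn_contraction Z (D s) x) (t x)
                + beta x (s x) (conn_contraction Z (D t) x).

Variable Cp : forall x, {vspace E x}.

(* Maximality is fibrewise: each fibre of [Cp] is a maximal positive-definite
   subspace, i.e. has rank n. *)
Definition generalized_metric : Prop :=
  is_subbundle Cp /\ forall x, maximal_posdef (pairing A x) (Cp x).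

Definition Cminus (x : M) : {vspace E x} :=
  orthogonal_complement (pairing A x) (Cp x).

Definition proj_plus (x : M) : 'End(E x) := daddv_pi (Cp x) (Cminus x).

Definition proj_minus (x : M) : 'End(E x) := daddv_pi (Cminus x) (Cp x).

Definition Gmetric (x : M) (a b : E x) : R :=
  pairing A x (proj_plus x a) (proj_plus x b)
  - pairing A x (proj_minus x a) (proj_minus x b).

(* The splitting E = T (+) T^* induced by G: T^* is the image of [coanchor] and
   T its G-orthogonal complement; [Cmap] is X + xi |-> X - xi. *)
Definition cotangent_in (x : M) : {vspace E x} := limg (coanchor A x).

Definition tangent_in (x : M) : {vspace E x} :=
  orthogonal_complement (@Gmetric x) (cotangent_in x).

Definition Cmap (x : M) : 'End(E x) :=
  daddv_pi (tangent_in x) (cotangent_in x)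
  - daddv_pi (cotangent_in x) (tangent_in x).

Definition sec_plus (Z : section E) : section E := fun x => proj_plus x (Z x).

Definition sec_minus (Z : section E) : section E := fun x => proj_minus x (Z x).

Definition sec_C (Z : section E) : section E := fun x => Cmap x (Z x).

Definition metric_operator (Z W : section E) : section E := fun x =>
  sec_plus (bracket A (sec_minus Z) (sec_plus W)) x
  + sec_minus (bracket A (sec_plus Z) (sec_minus W)) x
  + sec_minus (bracket A (sec_C (sec_minus Z)) (sec_minus W)) x
  + sec_plus (bracket A (sec_C (sec_plus Z)) (sec_plus W)) x.

End Courant.

(* Main.v *)
Require Import Defs.
From HB Require Import structures.
From mathcomp Require Import all_boot all_order all_algebra.
From mathcomp Require Import ring lra.
From mathcomp Require Import all_classical all_reals all_analysis.
Import numFieldNormedType.Exports.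
Import Order.TTheory GRing.Theory Num.Theory.

(* Each of the four brackets in D_Z W pairs a section a of one of C_+, C_- with a
   section b of the other, since C exchanges C_+ and C_-, and is projected to the
   summand containing b.  As <a,b> = 0, the bracket is skew on a, b, hence
   [fa,b] = f[a,b] - (pi(b)f) a, whose anomalous term is killed by the projection:
   D is linear over functions in Z.  Since pi(CZ) = pi(Z), the derivative terms in
   the Leibniz rule and in the invariance of <,> under the bracket add up to pi(Z)
   separately on C_+ and on C_-.

   The bracket is only defined on global sections, so that D_Z W is made into a
   section of E (x) E by tensoriality in Z, which needs smooth bump functions on
   M.  The projections to C_+- and the map C are smooth because they are
   orthogonal projections, given in local frames by inverse Gram matrices. *)

Set Implicit Arguments.
Unset Strict Implicit.
Unset Printing Implicit Defensive.

Local Open Scope classical_set_scope.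
Local Open Scope ring_scope.

(** * Differentiability classes on R^n *)

(** The naive summand [[Z_+,W_+]_+] is not linear over functions in [Z]: the bracket of two sections
    of [C_+] is skew only up to a differential, and the anomalous multiple of [Z_+] survives the
    projection. Replacing [Z_+] by [C Z_+] moves the first argument into [C_-] and keeps its anchor.
    That [C] exchanges [C_+] and [C_-] is seen through the involution [tau], equal to 1 on [C_+] and
    to -1 on [C_-]. One has [G(u,v) = <u, tau v>], and the cotangent part is its own orthogonal for
    the pairing, so [tau] swaps it with its [G]-orthogonal complement and anticommutes with [C].
    Negativity of the pairing on [C_-], hence positivity of [G], has to be derived from fibrewise
    maximality and nondegeneracy. *)

Lemma near_eq_diff (R : realType) (V W : normedModType R) (f g : V -> W) x :
  (\near x, f x = g x) -> differentiable f x ->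
  differentiable g x /\ 'd g x = 'd f x :> (V -> W).
Proof.
move=> fg df; have [dfc dfo] := (diff_locallyP _ _).1 df.
have go : g \o shift x = cst (g x) + 'd f x +o_ 0 id.
  apply/eqaddoP => e e0; have := (eqaddoP _ _ _ _).1 dfo e e0.
  have fg0 : \forall h \near 0, f (h + x) = g (h + x).
    by move: fg; rewrite (near_shift 0 x); apply: filterS => h; rewrite /= subr0.
  apply: filterS2 fg0 => h; rewrite !fctE /= => ->.
  by rewrite (nbhs_singleton fg).
have dg := diff_unique dfc go.
split; last exact: dg.
by apply/diff_locallyP; rewrite dg.
Qed.

Section Ndiff.
Context {R : realType} {n : nat}.
Implicit Types (U V : set 'rV[R]_n) (f g : 'rV[R]_n -> R^o).

Lemma ndiff_sub k U V f : U `<=` V -> ndiff k V f -> ndiff k U f.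
Proof.
elim: k f => // k IH f UV [df ndf]; split=> [x /UV /df //|i].
exact: IH (ndf i).
Qed.

(** Every clause of [ndiff] is tested at points of the set, on derivatives of the total function
    [f], so pointwise covers suffice. *)
Lemma ndiff_local k U f :
  (forall x, U x -> exists2 V, V x & ndiff k V f) -> ndiff k U f.
Proof.
elim: k f => // k IH f h; split=> [x /h [V Vx [df _]]|i]; first exact: df.
by apply: IH => x /h [V Vx [_ ndf]]; exists V => //; exact: ndf.
Qed.

Lemma ndiff_eq k U f g : open U -> (forall x, U x -> f x = g x) ->
  ndiff k U f -> ndiff k U g.
Proof.
move=> oU; elim: k f g => // k IH f g fg [df ndf].
have nfg x : U x -> \near x, f x = g x.
  by move=> Ux; exact: filterS fg (open_nbhs_nbhs (conj oU Ux)).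
split=> [x Ux|i]; first by have [] := near_eq_diff (nfg x Ux) (df x Ux).
by apply: IH (ndf i) => x Ux; exact: near_eq_derive (nfg x Ux).
Qed.

Lemma ndiffS k U f : ndiff k.+1 U f -> ndiff k U f.
Proof.
by elim: k f => // k IH f [df ndf]; split=> // i; exact: IH (ndf i).
Qed.

Lemma ndiff_cst k U (c : R^o) : ndiff k U (fun=> c).
Proof.
elim: k c => // k IH c; split=> [x _|i]; first exact: differentiable_cst.
by under eq_fun do rewrite derive_cst; exact: IH.
Qed.

Lemma ndiffD k U f g : open U -> ndiff k U f -> ndiff k U g ->
  ndiff k U (fun x => f x + g x).
Proof.
move=> oU; elim: k f g => // k IH f g [df nf] [dg ng].
split=> [x Ux|i]; first exact: differentiableD (df x Ux) (dg x Ux).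
apply: ndiff_eq (IH _ _ (nf i) (ng i)) => // x Ux.
by rewrite -deriveD //; apply: diff_derivable; [exact: df|exact: dg].
Qed.

Lemma ndiffM k U f g : open U -> ndiff k U f -> ndiff k U g ->
  ndiff k U (fun x => f x * g x).
Proof.
move=> oU; elim: k f g => // k IH f g Hf Hg.
have [[df nf] [dg ng]] := (Hf, Hg).
split=> [x Ux|i]; first exact: differentiableM (df x Ux) (dg x Ux).
have := ndiffD oU (IH _ _ (ndiffS Hf) (ng i)) (IH _ _ (ndiffS Hg) (nf i)).
apply: ndiff_eq => // x Ux.
by rewrite [RHS]deriveM //; apply: diff_derivable; [exact: df|exact: dg].
Qed.

Lemma ndiff_sum k U (I : Type) (r : seq I) (P : pred I) (f : I -> 'rV[R]_n -> R^o) :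
  open U -> (forall i, P i -> ndiff k U (f i)) ->
  ndiff k U (fun x => \sum_(i <- r | P i) f i x).
Proof.
move=> oU Hf; elim: r => [|i r IH].
  by under eq_fun do rewrite big_nil; exact: ndiff_cst.
under eq_fun do rewrite big_cons; case Pi : (P i) => //.
exact: ndiffD (Hf i Pi) IH.
Qed.

Lemma ndiff_prod k U (I : Type) (r : seq I) (P : pred I) (f : I -> 'rV[R]_n -> R^o) :
  open U -> (forall i, P i -> ndiff k U (f i)) ->
  ndiff k U (fun x => \prod_(i <- r | P i) (f i x : R)).
Proof.
move=> oU Hf; elim: r => [|i r IH].
  by under eq_fun do rewrite big_nil; exact: ndiff_cst.
under eq_fun do rewrite big_cons; case Pi : (P i) => //.
exact: ndiffM (Hf i Pi) IH.
Qed.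

Lemma ndiffV k U f : open U -> (forall x, U x -> f x != 0) ->
  ndiff k U f -> ndiff k U (fun x => (f x)^-1).
Proof.
move=> oU f0; elim: k => // k IH Hf; have [df nf] := Hf.
split=> [x Ux|i]; first exact: differentiableV (df x Ux) (f0 x Ux).
have If := IH (ndiffS Hf).
have := ndiffM oU (ndiffM oU (ndiff_cst k U (-1)) (ndiffM oU If If)) (nf i).
apply: ndiff_eq => // x Ux.
rewrite [RHS]deriveV ?f0 //; last by apply: diff_derivable; exact: df.
by rewrite mulN1r -invfM -expr2.
Qed.

Lemma ndiff_coord k U (i : 'I_n) : ndiff k U (fun x => x ord0 i).
Proof.
case: k => // k; split=> [x _|j]; first exact: differentiable_coord.
have -> : (fun x => 'D_(delta_mx ord0 j) (fun x : 'rV[R]_n => x ord0 i : R^o) x)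
    = fun=> (delta_mx ord0 j : 'rV[R]_n) ord0 i; last exact: ndiff_cst.
apply/funext => x; rewrite deriveE; last exact: differentiable_coord.
have @l : {linear 'rV[R]_n -> R^o}.
  by exists (fun N : 'rV[R]_n => N ord0 i); do 2![eexists]; do ?[constructor];
     rewrite ?mxE// => ? *; rewrite ?mxE//; move=> ?; rewrite !mxE.
by rewrite (_ : (fun x : 'rV[R]_n => _) = l) // diff_lin //; exact: coord_continuous.
Qed.

End Ndiff.

Section NdiffComp.
Context {R : realType} {m n : nat}.
Implicit Types (g : 'rV[R]_n -> 'rV[R]_m).

Lemma differentiable_row g x :
  (forall j, differentiable (fun y => g y ord0 j : R^o) x) -> differentiable g x.
Proof.
move=> dg; have -> : g = \sum_(j < m) (fun y => g y ord0 j *: delta_mx ord0 j).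
  apply/funext => y; rewrite {1}[g y]row_sum_delta fct_sumE; apply: eq_bigr => j _ //.
by apply: differentiable_sum => j; exact: differentiableZl (dg j).
Qed.

Lemma diff_row g x v j : differentiable g x ->
  'd g x v ord0 j = 'd (fun y => g y ord0 j : R^o) x v.
Proof.
move=> dg; have @l : {linear 'rV[R]_m -> R^o}.
  by exists (fun N : 'rV[R]_m => N ord0 j); do 2![eexists]; do ?[constructor];
     rewrite ?mxE// => ? *; rewrite ?mxE//; move=> ?; rewrite !mxE.
have cl : continuous l by exact: coord_continuous.
have dl : differentiable l (g x) by exact: linear_differentiable.
by rewrite (_ : (fun y => _) = l \o g) // (diff_comp dg dl) /= (diff_lin _ cl).
Qed.

(** By the chain rule, a partial derivative of [f \o g] is a sum of products of partials of [g] with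
    partials of [f] composed with [g]; the latter are again compositions, at order one less. *)
Lemma ndiff_comp k (U : set 'rV[R]_n) (V : set 'rV[R]_m) g (f : 'rV[R]_m -> R^o) :
  open U -> (forall x, U x -> V (g x)) ->
  (forall j, ndiff k U (fun x => g x ord0 j)) -> ndiff k V f ->
  ndiff k U (f \o g).
Proof.
move=> oU gUV; elim: k f => // k IH f Hg [df nf].
have dg x : U x -> differentiable g x.
  by move=> Ux; apply: differentiable_row => j; have [+ _] := Hg j; apply.
split=> [x Ux|i].
  by apply: differentiable_comp; [exact: dg|exact/df/gUV].
have : ndiff k U (fun x => \sum_(j < m)
    ('D_(delta_mx ord0 i) (fun y => g y ord0 j : R^o) x : R)
    * ('D_(delta_mx ord0 j) f (g x))).
  apply: ndiff_sum => // j _; apply: ndiffM => //; first by have [_] := Hg j; apply.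
  by apply: IH (nf j) => j'; exact/ndiffS.
apply: ndiff_eq => // x Ux.
have dfx := df _ (gUV _ Ux).
rewrite deriveE; last by apply: differentiable_comp => //; exact: dg.
rewrite diff_comp //; last exact: dg.
have -> : ('d f (g x) \o 'd g x) (delta_mx ord0 i) = 'd f (g x) (\sum_(j < m)
    'd g x (delta_mx ord0 i) ord0 j *: delta_mx ord0 j).
  by rewrite /= [X in 'd f (g x) X]row_sum_delta.
rewrite linear_sum; apply: eq_bigr => j _.
rewrite linearZ -(deriveE _ dfx) (diff_row _ j (dg x Ux)) -deriveE //.
by have [+ _] := Hg j; apply.
Qed.

End NdiffComp.

(** * A smooth function flat at 0 *)

Section FlatFunction.
Variable R : realType.
Implicit Types (t : R) (m : nat).

(* [flat m] is [t |-> t^-m exp(-1/t)] extended by 0 to [t <= 0]: this family is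
   closed under differentiation up to linear combinations. *)
Definition flat m t : R := if 0 < t then t^-1 ^+ m * expR (- t^-1) else 0.

Lemma flat_gt0 m t : 0 < t -> 0 < flat m t.
Proof. by move=> t0; rewrite /flat t0 mulr_gt0 ?expR_gt0 ?exprn_gt0 ?invr_gt0. Qed.

Lemma flat_le0 m t : t <= 0 -> flat m t = 0.
Proof. by rewrite /flat; case: ltP. Qed.

(** The exponential of [t^-1] dominates its Taylor term of order [m + 2]. The factor [t ^+ 2] left
    over makes the difference quotient at 0 tend to 0. *)
Lemma flat_le m t : `|flat m t| <= m.+2`!%:R * t ^+ 2.
Proof.
have [t0|t0] := leP t 0.
  by rewrite flat_le0 // normr0 mulr_ge0 ?ler0n ?sqr_ge0.
have s0 : 0 < t^-1 by rewrite invr_gt0.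
rewrite gtr0_norm ?flat_gt0 // /flat t0 expRN ler_pdivrMr ?expR_gt0 //.
have f0 : 0 < (m.+2`!%:R : R) by rewrite ltr0n fact_gt0.
have : t^-1 ^+ m.+2 / m.+2`!%:R <= expR t^-1.
  by apply: le_trans (expR_ge1Dxn m.+1 (ltW s0)); rewrite lerDr.
rewrite ler_pdivrMr // => h.
have -> : t^-1 ^+ m = t^-1 ^+ m.+2 * t ^+ 2.
  by rewrite -addn2 exprD -mulrA -exprMn mulVf ?gt_eqF // expr1n mulr1.
rewrite [leRHS]mulrAC [_`!%:R * _]mulrC; apply: ler_wpM2r => //; exact: sqr_ge0.
Qed.

Lemma flat_derive m t :
  is_derive t 1 (flat m : R -> R^o) (flat m.+2 t - m%:R * flat m.+1 t).
Proof.
have [t0|t0|->] := ltgtP t 0.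
- rewrite !(flat_le0 _ (ltW t0)) mulr0 subrr.
  apply: (@near_eq_is_derive _ _ _ (cst 0)).
  near=> u; rewrite flat_le0 // ltW //; near: u; exact: lt_nbhsl.
- apply: (@near_eq_is_derive _ _ _ (fun t => t^-1 ^+ m * expR (- t^-1))).
    near=> u; rewrite /flat ifT //; near: u; exact: lt_nbhsr.
  have tn0 : t != 0 by rewrite gt_eqF.
  have iV : is_derive t 1 (GRing.inv : R -> R) (- t ^- 2).
    apply: DeriveDef; first by apply: (derivableV (f := id)).
    by rewrite (deriveV (f := id)) // derive_id [LHS]mulr1.
  have iE : is_derive t 1 (expR \o - (GRing.inv : R -> R)) (expR (- t^-1) * t ^- 2).
    by rewrite -[t ^- 2]opprK; apply: is_derive1_comp.
  rewrite (_ : (fun _ => _) =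
      (GRing.inv : R -> R) ^+ m * (expR \o - (GRing.inv : R -> R))); last first.
    by apply/funext => u; rewrite fctE exprfctE.
  apply: is_derive_eq (is_deriveM (is_deriveX m iV) iE) _.
  rewrite /flat t0 -exprVn /= /GRing.scale /=.
  have -> : ((GRing.inv : R -> R) ^+ m) t = t^-1 ^+ m by rewrite exprfctE.
  case: m => [|m] /=; first by rewrite !mul0r mulr0 subr0 !mul1r; ring.
  by rewrite !exprS; ring.
(* At 0 the derivative is computed by hand: by [flat_le] the quotient at [h] is at most [(m+2)! |h|]
   in absolute value. *)
- rewrite !flat_le0 // mulr0 subrr.
  have h0 : (fun h : R => h^-1 *: ((flat m \o shift 0) (h *: (1 : R)) - flat m 0))
      @ 0^' --> (0 : R^o).
    apply/cvgrPdist_le => /= e e0; near=> h.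
    have hn0 : h != 0 by near: h; exact: nbhs_dnbhs_neq.
    rewrite sub0r normrN (flat_le0 m (lexx 0)) subr0 /= addr0 [h *: 1]mulr1 normrM normfV.
    rewrite ler_pdivrMl ?normr_gt0 //; apply: le_trans (flat_le _ _) _.
    rewrite -real_normK ?num_real // expr2 mulrA [leRHS]mulrC; apply: ler_wpM2r => //.
    have f0 : 0 < (m.+2`!%:R : R) by rewrite ltr0n fact_gt0.
    rewrite -ler_pdivlMl //; near: h; apply: dnbhs0_le.
    by rewrite mulr_gt0 ?invr_gt0.
  apply: DeriveDef; first by apply: cvgP h0.
  exact: cvg_lim h0.
Unshelve. all: by end_near. Qed.

(** The induction on [k] keeps [m] general, since differentiating [flat m] brings in [flat m.+1] and
    [flat m.+2]. *)
Lemma ndiff_flat n k m (U : set 'rV[R]_n) (q : 'rV[R]_n -> R^o) :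
  open U -> ndiff k U q -> ndiff k U (fun x => flat m (q x)).
Proof.
move=> oU; elim: k m => // k IH m Hq; have [dq nq] := Hq.
have df t : differentiable (flat m : R^o -> R^o) t.
  by apply/derivable1_diffP; have [] := flat_derive m t.
split=> [x Ux|i]; first exact: differentiable_comp (dq x Ux) (df _).
have IHm m' := IH m' (ndiffS Hq).
have := ndiffM oU (nq i) (ndiffD oU (IHm m.+2)
  (ndiffM oU (ndiff_cst k U (- m%:R)) (IHm m.+1))).
apply: ndiff_eq => // x Ux.
rewrite [RHS]deriveE; last exact: differentiable_comp (dq x Ux) (df _).
rewrite (diff_comp (dq x Ux) (df _)) /= -(deriveE _ (dq x Ux)).
rewrite -[X in 'd _ _ X]mulr1 [RHS]linearZ -(deriveE _ (df (q x))) mulNr.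
by have [_ ->] := flat_derive m (q x).
Qed.

End FlatFunction.

(** * Smooth functions on a manifold *)

Section SmoothOn.
Context {R : realType} {n : nat} {M : smoothManifold R n}.
Implicit Types (U V : set M) (f g : M -> R).

Lemma chart_open (i : chart_idx M) U :
  open U -> open (@chart _ _ M i @` (chart_dom i `&` U)).
Proof.
move=> oU; rewrite openE => _ [x [dx Ux] <-].
have nimg : nbhs (chart i x) (@chart _ _ M i @` chart_dom i).
  by apply: open_nbhs_nbhs; split; [exact: chart_img_open|exists x].
have ninv : \forall u \near chart i x, U (chart_inv i u).
  apply: chart_inv_continuous => //; rewrite chartK //.
  exact: open_nbhs_nbhs (conj oU Ux).
apply: filterS2 nimg ninv => _ [y dy <-]; rewrite chartK // => Uy.
by exists y.
Qed.

Lemma smooth_on_sub U V f : U `<=` V -> smooth_on V f -> smooth_on U f.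
Proof.
move=> UV sf i k; apply: ndiff_sub (sf i k).
by move=> _ [x [dx Ux] <-]; exists x => //; split=> //; exact: UV.
Qed.

Lemma smooth_on_local U f :
  (forall x, U x -> exists2 V, V x & smooth_on V f) -> smooth_on U f.
Proof.
move=> h i k; apply: ndiff_local => _ [x [dx Ux] <-].
by have [V Vx sf] := h x Ux; exists (chart i @` (chart_dom i `&` V)); [exists x|exact: sf].
Qed.

Lemma smooth_on_eq U f g : open U -> (forall x, U x -> f x = g x) ->
  smooth_on U f -> smooth_on U g.
Proof.
move=> oU fg sf i k; apply: ndiff_eq (sf i k); first exact: chart_open.
by move=> _ [x [dx Ux] <-]; rewrite /= chartK // fg.
Qed.

Lemma smooth_on_cst U (c : R) : smooth_on U (fun=> c).
Proof. by move=> i k; exact: ndiff_cst. Qed.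

Lemma smooth_onD U f g : open U -> smooth_on U f -> smooth_on U g ->
  smooth_on U (fun x => f x + g x).
Proof. by move=> oU sf sg i k; apply: ndiffD (sf i k) (sg i k); exact: chart_open. Qed.

Lemma smooth_onM U f g : open U -> smooth_on U f -> smooth_on U g ->
  smooth_on U (fun x => f x * g x).
Proof. by move=> oU sf sg i k; apply: ndiffM (sf i k) (sg i k); exact: chart_open. Qed.

Lemma smooth_onN U f : open U -> smooth_on U f -> smooth_on U (fun x => - f x).
Proof.
move=> oU sf; under eq_fun do rewrite -mulN1r.
by apply: smooth_onM => //; exact: smooth_on_cst.
Qed.

Lemma smooth_onV U f : open U -> (forall x, U x -> f x != 0) ->
  smooth_on U f -> smooth_on U (fun x => (f x)^-1).
Proof.
move=> oU f0 sf i k; apply: ndiffV (sf i k); first exact: chart_open.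
by move=> _ [x [dx Ux] <-]; rewrite /= chartK // f0.
Qed.

Lemma smooth_on_sum U (I : Type) (r : seq I) (P : pred I) (f : I -> M -> R) :
  open U -> (forall i, P i -> smooth_on U (f i)) ->
  smooth_on U (fun x => \sum_(i <- r | P i) f i x).
Proof.
move=> oU sf i k; apply: (@ndiff_sum _ _ _ _ _ _ _ (fun j => f j \o chart_inv i)).
  exact: chart_open.
by move=> j Pj; exact: sf.
Qed.

Lemma smooth_on_prod U (I : Type) (r : seq I) (P : pred I) (f : I -> M -> R) :
  open U -> (forall i, P i -> smooth_on U (f i)) ->
  smooth_on U (fun x => \prod_(i <- r | P i) f i x).
Proof.
move=> oU sf i k; apply: (@ndiff_prod _ _ _ _ _ _ _ (fun j => f j \o chart_inv i)).
  exact: chart_open.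
by move=> j Pj; exact: sf.
Qed.

Lemma smooth_on_chart (j : chart_idx M) U (B : 'rV[R]_n -> R^o) :
  open U -> U `<=` chart_dom j -> smooth_Rn setT B ->
  smooth_on U (B \o chart j).
Proof.
move=> oU Uj sB i k.
apply: (ndiff_comp (g := chart j \o chart_inv i) (V := setT)) => //.
- exact: chart_open.
- move=> l; apply: ndiff_sub (chart_smooth i j l k).
  by move=> _ [x [dx Ux] <-]; exists x => //; split=> //; exact: Uj.
Qed.

Lemma smooth_at_differentiable U f x : open U -> U x -> smooth_on U f ->
  differentiable (f \o chart_inv (chart_at x) : 'rV[R]_n -> R^o)
    (chart (chart_at x) x).
Proof.
move=> oU Ux sf; have [+ _] := sf (chart_at x) 1%N; apply.
by exists x => //; split=> //; exact: chart_atP.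
Qed.

Lemma differentialE f x v :
  differential f x v = 'd (f \o chart_inv (chart_at x) : 'rV[R]_n -> R^o)
    (chart (chart_at x) x) v.
Proof. by rewrite lfunE. Qed.

Lemma differentialD f g x : smooth_fun f -> smooth_fun g ->
  differential (fun y => f y + g y) x = differential f x + differential g x.
Proof.
move=> sf sg; apply/lfunP => v; rewrite add_lfunE.
have df := smooth_at_differentiable openT (I : setT x) sf.
have dg := smooth_at_differentiable openT (I : setT x) sg.
have dfg := congr1 (fun F : _ -> _ => F v) (diffD df dg).
apply: etrans (etrans (differentialE _ x v) dfg) _.
exact: esym (congr2 +%R (differentialE f x v) (differentialE g x v)).
Qed.

Lemma differential_cst (c : R) x : differential (fun _ : M => c) x = 0.
Proof.
apply/lfunP => v; rewrite zero_lfunE.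
have d0 := congr1 (fun F : _ -> _ => F v)
  (diff_cst (c : R^o) (chart (chart_at x) x)).
exact: etrans (differentialE _ x v) d0.
Qed.

Lemma differentialN f x : smooth_fun f ->
  differential (fun y => - f y) x = - differential f x.
Proof.
move=> sf; apply/eqP; rewrite -subr_eq0 opprK -differentialD //.
  by apply/eqP; under eq_fun do rewrite addNr; rewrite differential_cst.
exact: smooth_onN openT sf.
Qed.

End SmoothOn.

(** * Bump functions *)

Section Bump.
Context {R : realType} {n : nat} {M : smoothManifold R n}.

(** The Euclidean square norm makes the argument of [flat] a polynomial in the coordinates, hence
    smooth, which the sup norm of ['rV[R]_n] would not. *)
Definition rV_bump (u0 : 'rV[R]_n) (r : R) (u : 'rV[R]_n) : R^o :=
  flat 0 (r ^+ 2 - \sum_k (u ord0 k - u0 ord0 k) ^+ 2).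

Lemma rV_bump_smooth u0 r : smooth_Rn setT (rV_bump u0 r).
Proof.
move=> k; apply: ndiff_flat; first exact: openT.
apply: ndiffD; [exact: openT|exact: ndiff_cst|].
under eq_fun do rewrite -sumrN.
apply: ndiff_sum => [|i _]; first exact: openT.
under eq_fun do rewrite expr2 -mulNr opprB.
have oT := @openT 'rV[R]_n.
apply: ndiffM => //; apply: ndiffD => //; try exact: ndiff_cst; try exact: ndiff_coord.
under eq_fun do rewrite -mulN1r.
by apply: ndiffM => //; [exact: ndiff_cst|exact: ndiff_coord].
Qed.

Lemma rV_bump_gt0 u0 r : r != 0 -> 0 < rV_bump u0 r u0.
Proof.
move=> r0; apply: flat_gt0.
under eq_bigr do rewrite subrr expr0n.
by rewrite sumr_const mul0rn subr0 exprn_even_gt0 //= r0.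
Qed.

Lemma rV_bump_neq0 u0 r u k : 0 < r -> rV_bump u0 r u != 0 ->
  `|u ord0 k - u0 ord0 k| <= r.
Proof.
move=> r0; rewrite /rV_bump /flat; case: ifPn; rewrite ?eqxx // subr_gt0 => h _.
rewrite -ler_sqr ?nnegrE ?normr_ge0 ?(ltW r0) // real_normK ?num_real //.
apply: ltW; apply: le_lt_trans h; rewrite (bigD1 k) //= lerDl.
by apply: sumr_ge0 => i _; exact: sqr_ge0.
Qed.

(* [chi] is supported in the closed set [K], so that [chi] times an object smooth
   on [U] is smooth on the whole manifold. *)
Lemma smooth_bump (U : set M) (x0 : M) : open U -> U x0 ->
  exists (chi : M -> R) (K : set M),
    [/\ smooth_fun chi, chi x0 = 1, closed K, K `<=` U &
        forall x, ~ K x -> chi x = 0].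
Proof.
move=> oU Ux0; pose c := chart_at x0; pose u0 := chart c x0.
pose W := chart_dom c `&` U.
have oW : open W by apply: openI => //; exact: chart_dom_open.
have Wx0 : W x0 by split => //; exact: chart_atP.
have : nbhs u0 (@chart _ _ M c @` W).
  by apply: open_nbhs_nbhs; split; [exact: chart_open|exists x0].
(* Half the radius, so that the closed cube of half-side [r] lies in the open sup-norm ball of
   radius [e]. *)
move=> /nbhs_ballP [e /= e0 eW]; pose r := e / 2.
have r0 : 0 < r by rewrite divr_gt0.
pose K' : set 'rV[R]_n := [set u | forall k, `[u0 ord0 k - r, u0 ord0 k + r]%classic (u ord0 k)].
have K'W : K' `<=` chart c @` W.
  move=> u K'u; apply: eW; rewrite -ball_normE /= /Num.norm /= mx_normrE.
  apply: bigmax_lt => // [[i k]] _ /=; rewrite ord1 !mxE.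
  have := K'u k; rewrite /= in_itv /= => /andP[h1 h2].
  apply: (@le_lt_trans _ _ r); last by rewrite /r; lra.
  by rewrite ler_distl; apply/andP; split; lra.
have cK' : compact K'.
  apply: (@rV_compact R n (fun k => `[u0 ord0 k - r, u0 ord0 k + r]%classic)) => k.
  exact: segment_compact.
pose K := chart_inv c @` K'.
have KW : K `<=` W by move=> _ [u /K'W [y Wy <-] <-]; rewrite chartK //; case: Wy.
(* [K] is a continuous image of a compact cube, and compact sets are closed because [M] is
   Hausdorff. *)
have cK : closed K.
  apply: compact_closed; first exact: carrier_hausdorff.
  apply: continuous_compact cK'; apply: continuous_in_subspaceT => u.
  rewrite inE => /K'W [y [dy _] <-]; exact: chart_inv_continuous.
pose B := rV_bump u0 r.
have B0 : 0 < B u0 by apply: rV_bump_gt0; rewrite gt_eqF.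
pose chi y : R := if `[<W y>] then (B u0)^-1 * B (chart c y) else 0.
have chiK y : ~ K y -> chi y = 0.
  rewrite /chi; case: asboolP => // -[dy Uy] nK.
  have [->|/(rV_bump_neq0 _ r0) h] := eqVneq (B (chart c y)) 0; first by rewrite mulr0.
  case: nK; exists (chart c y); last by rewrite chartK.
  move=> k; have := h k; rewrite /= in_itv /= ler_distl => /andP[h1 h2].
  by apply/andP; split; lra.
exists chi, K; split => //; last first.
- by move=> x /KW [].
- by rewrite /chi asboolT // mulVf // gt_eqF.
(* [W] and the complement of [K] cover [M]: on the first [chi] is read in the chart, on the second
   it vanishes. *)
apply: smooth_on_local => y _; have [Ky|nKy] := pselect (K y).
  exists W; first exact: KW.
  have sB := rV_bump_smooth u0 r.
  have := smooth_onM oW (smooth_on_cst W (B u0)^-1)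
    (smooth_on_chart oW (fun y Wy => proj1 Wy) sB).
  by apply: smooth_on_eq => // x Wx; rewrite /chi asboolT.
exists (~` K) => //; have oK : open (~` K) by exact: closed_openC.
by apply: smooth_on_eq (smooth_on_cst _ 0) => // x /chiK ->.
Qed.

End Bump.

(** * Coordinate coframes *)

Section CoordForms.
Context {R : realType} {n : nat} {M : smoothManifold R n}.

(** These are [n] forms in dimension [n], so freeness is enough; it follows by evaluating on the
    coordinate vectors of the same chart. *)
Lemma coord_form_basis (i : chart_idx M) x : chart_dom i x ->
  basis_of fullv [tuple coord_form i k x | k < n].
Proof.
move=> dx; rewrite basisEfree subvf size_tuple dimvf /=.
have -> : dim 'Hom('rV[R]_n, R^o) = ((1 * n) * 1)%N by [].
rewrite mul1n muln1 leqnn andbT; apply/(@freeP _ _ n [tuple coord_form i k x | k < n]) => c sum0 l.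
set j := chart_at x; set u := chart j x; set w := chart i x.
have dj : chart_dom j x by exact: chart_atP.
have dphi : differentiable (@chart _ _ M j \o chart_inv i) w.
  apply: differentiable_row => k; have [+ _] := chart_smooth i j k 1; apply.
  by exists x.
have dpsi : differentiable (@chart _ _ M i \o chart_inv j) u.
  apply: differentiable_row => k; have [+ _] := chart_smooth j i k 1; apply.
  by exists x.
have phiw : (chart j \o chart_inv i) w = u by rewrite /= chartK.
have dpsi' := dpsi; rewrite -phiw in dpsi'.
(* The [l]-th coordinate vector of chart [i], read in the preferred chart [j]. The chain rule for a
   transition map followed by its inverse sends it back to [delta_mx ord0 l]. *)
pose v : 'rV[R]_n := 'd (@chart _ _ M j \o chart_inv i) w (delta_mx ord0 l).
have idE : 'd (@chart _ _ M i \o chart_inv j) u v = delta_mx ord0 l.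
  rewrite /v -phiw -[LHS]/(('d _ _ \o 'd _ _) _) -(diff_comp dphi dpsi').
  have oW : open (@chart _ _ M i @` (chart_dom i `&` chart_dom j)).
    by apply: chart_open; exact: chart_dom_open.
  have id_near : \near w, id w = ((chart i \o chart_inv j) \o (chart j \o chart_inv i)) w.
    apply: filterS (open_nbhs_nbhs (conj oW _)); last by exists x.
    by move=> _ [y [dy dy'] <-]; rewrite /= !chartK.
  have cid : continuous (idfun : 'rV[R]_n -> 'rV[R]_n) by move=> ?; exact: cvg_id.
  have [_ ->] := near_eq_diff id_near (linear_differentiable (f := idfun) w cid).
  by rewrite (diff_lin (f := idfun) _ cid).
have vE k : coord_form i k x v = (l == k)%:R.
  apply: etrans (differentialE _ x v) _.
  by rewrite -[LHS](diff_row v k dpsi) idE mxE eqxx eq_sym.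
have := congr1 (fun F : 'Hom('rV[R]_n, R^o) => F v) sum0.
rewrite sum_lfunE zero_lfunE => <-.
have Xk (k : 'I_n) : [tuple coord_form i k x | k < n]`_k = coord_form i k x.
  by rewrite -tnth_nth tnth_mktuple.
under eq_bigr do rewrite scale_lfunE Xk vE.
rewrite (bigD1 l) //= big1 ?addr0 => [|k kl]; first by rewrite eqxx [RHS]mulr1.
by rewrite eq_sym (negbTE kl) scaler0.
Qed.

End CoordForms.

(** * Orthogonal projections and generalized metrics on one fibre *)

Section OrthogonalDecomposition.
Context {R : realType} {V : vectType R}.
Implicit Types (b : {biscalar V}) (C : {vspace V}).

Definition nondegenerate_on (b : V -> V -> R) C :=
  forall u, u \in C -> (forall v, v \in C -> b v u = 0) -> u = 0.

Definition gram (b : V -> V -> R) r (e : r.-tuple V) : 'M[R]_r :=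
  \matrix_(i, j) b (tnth e i) (tnth e j).

Lemma coord_basis_tnth C r (e : r.-tuple V) u : basis_of C e -> u \in C ->
  u = \sum_i coord e i u *: tnth e i.
Proof.
move=> eC uC; rewrite {1}(coord_basis eC uC).
by apply: eq_bigr => i _; rewrite (tnth_nth 0).
Qed.

Lemma gram_mul b r (e : r.-tuple V) (c : 'cV[R]_r) i :
  (gram b e *m c) i ord0 = b (tnth e i) (\sum_j c j ord0 *: tnth e j).
Proof.
rewrite mxE linear_sumr; apply: eq_bigr => j _.
by rewrite !mxE linearZr_LR mulrC.
Qed.

(** A null column of the Gram matrix is the coordinate column of a vector of [C] that pairs to zero
    with all of [C]. The transpose appears because [kermx] gives null rows. *)
Lemma gram_unit b C r (e : r.-tuple V) :
  basis_of C e -> nondegenerate_on b C -> gram b e \in unitmx.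
Proof.
move=> eC nd; rewrite -unitmx_tr -row_free_unit -kermx_eq0.
apply/eqP/row_matrixP => k; rewrite row0; set v := row k _.
have : gram b e *m v^T = 0.
  by apply: trmx_inj; rewrite trmx_mul trmxK -row_mul mulmx_ker row0 trmx0.
set c := v^T => gc0.
have c0 : \sum_j c j ord0 *: tnth e j = 0.
  apply: nd => [|w wC].
    by apply: rpred_sum => j _; apply: rpredZ; exact: basis_mem eC (mem_tnth _ _).
  rewrite (coord_basis_tnth eC wC) linear_sumlz big1 // => i _.
  by rewrite linearZl_LR -gram_mul gc0 mxE mulr0.
have /freeP fe := basis_free eC.
apply/rowP => j; rewrite [RHS]mxE; have <- : c j ord0 = v ord0 j by exact: mxE.
apply: (fe (fun j => c j ord0)); rewrite -[RHS]c0; apply: eq_bigr => j' _.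
by rewrite (tnth_nth 0).
Qed.

Lemma orthogonal_cap b C : nondegenerate_on b C ->
  (C :&: orthogonal_complement b C)%VS = 0%VS.
Proof.
move=> nd; apply/vspaceP => u; rewrite memv_cap memv0; apply/idP/eqP => [|->].
  by move=> /andP[uC /orthogonal_complementP uC']; apply: nd.
by rewrite !mem0v.
Qed.

Lemma orthogonal_add b C : nondegenerate_on b C ->
  (C + orthogonal_complement b C)%VS = fullv.
Proof.
move=> nd; apply/vspaceP => v; rewrite memvf.
set e := vbasis C; have eC := vbasisP C.
(* The coordinates of the orthogonal projection of [v] to [C], obtained by solving the Gram
   system. *)
pose c := invmx (gram b e) *m \col_i b (tnth e i) v.
pose u := \sum_j c j ord0 *: tnth e j.
rewrite -[v](subrKC u); apply: memv_add.
  by apply: rpred_sum => j _; apply: rpredZ; exact: basis_mem eC (mem_tnth _ _).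
apply/orthogonal_complementP => w wC.
rewrite (coord_basis_tnth eC wC) linear_sumlz big1 // => i _.
rewrite linearZl_LR linearBr -[b _ u]gram_mul mulKVmx ?(gram_unit eC nd) //.
by rewrite !mxE subrr mulr0.
Qed.

Lemma posdef_nondegenerate b C : posdef_on b C -> nondegenerate_on b C.
Proof.
move=> pd u uC /(_ u uC) h; apply/eqP/negPn/negP => u0.
by have := pd u uC u0; rewrite h ltxx.
Qed.

End OrthogonalDecomposition.

(** * A maximal positive-definite subspace and its orthogonal complement *)

Section GeneralizedMetricFibre.
Context {R : realType} {V : vectType R}.
Variables (b : {biscalar V}) (Cp : {vspace V}).
Hypothesis b_sym : forall u v, b u v = b v u.
Hypothesis b_nd : nondegenerate_form b.
Hypothesis b_max : maximal_posdef b Cp.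

Let bDl u v w : b (u + v) w = b u w + b v w.
Proof. exact: linearDl. Qed.
Let bDr u v w : b w (u + v) = b w u + b w v.
Proof. exact: linearDr. Qed.
Let bZl k u v : b (k *: u) v = k * b u v.
Proof. exact: linearZl_LR. Qed.
Let bZr k u v : b u (k *: v) = k * b u v.
Proof. exact: linearZr_LR. Qed.
Let b0l v : b 0 v = 0.
Proof. exact: linear0l. Qed.

Let Cm := orthogonal_complement b Cp.
Let P := daddv_pi Cp Cm.
Let N := daddv_pi Cm Cp.
Let G u v := b (P u) (P v) - b (N u) (N v).

Lemma fibre_cap : (Cp :&: Cm)%VS = 0%VS.
Proof. exact/orthogonal_cap/posdef_nondegenerate/b_max.1. Qed.

Lemma fibre_projD v : P v + N v = v.
Proof.
apply: daddv_pi_add; first exact: fibre_cap.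
by rewrite orthogonal_add ?memvf //; exact/posdef_nondegenerate/b_max.1.
Qed.

Lemma fibre_plus_id v : v \in Cp -> P v = v.
Proof. exact/daddv_pi_id/fibre_cap. Qed.

Lemma fibre_minus_id v : v \in Cm -> N v = v.
Proof. by apply: daddv_pi_id; rewrite capvC; exact: fibre_cap. Qed.

Lemma fibre_minus_plus v : v \in Cp -> N v = 0.
Proof. by move=> vp; apply: (addrI v); rewrite addr0 -{1}(fibre_plus_id vp) fibre_projD. Qed.

Lemma fibre_plus_minus v : v \in Cm -> P v = 0.
Proof. by move=> vm; apply: (addIr v); rewrite add0r -{2}(fibre_minus_id vm) fibre_projD. Qed.

Lemma fibre_orth u v : u \in Cp -> v \in Cm -> b u v = 0.
Proof. by move=> up /orthogonal_complementP; apply. Qed.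

Lemma fibre_orth_proj u v : b (P u) (N v) = 0.
Proof. by apply: fibre_orth; exact: memv_pi. Qed.

Lemma fibre_pairingE u v : b u v = b (P u) (P v) + b (N u) (N v).
Proof.
rewrite -{1}(fibre_projD u) -{1}(fibre_projD v) bDl !bDr.
by rewrite (fibre_orth_proj u v) [b (N u) (P v)]b_sym (fibre_orth_proj v u) addr0 add0r.
Qed.

(** A vector of [Cm] with positive square could be added to [Cp], against maximality. *)
Lemma fibre_minus_le0 v : v \in Cm -> b v v <= 0.
Proof.
move=> vm; rewrite leNgt; apply/negP => v0.
have vn0 : v != 0 by apply: contraTneq v0 => ->; rewrite b0l ltxx.
have pd : posdef_on b (Cp + <[v]>)%VS.
  move=> w /memv_addP [u up [_ /vlineP [k ->] ->]] w0.
  rewrite bDl !bDr !bZl !bZr.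
  rewrite [b v u]b_sym (fibre_orth up vm) !mulr0 addr0 add0r.
  have [u0|u0] := eqVneq u 0.
    rewrite u0 b0l add0r mulrA mulr_gt0 // -expr2 exprn_even_gt0 //=.
    by apply: contra_neq w0 => ->; rewrite u0 scale0r addr0.
  apply: ltr_wpDr; last exact: b_max.1.
  by rewrite mulrA; apply: mulr_ge0 (ltW v0); rewrite -expr2 sqr_ge0.
have CpE := b_max.2 _ pd (addvSl _ _).
have : v \in (Cp :&: Cm)%VS.
  by rewrite memv_cap vm andbT -CpE; apply/(subvP (addvSr _ _)); exact: memv_line.
by rewrite fibre_cap memv0 (negbTE vn0).
Qed.

(* A null vector of the semidefinite form on [Cm] is orthogonal to [Cm]. *)
Lemma fibre_minus_lt0 v : v \in Cm -> v != 0 -> b v v < 0.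
Proof.
move=> vm vn0; rewrite lt_neqAle fibre_minus_le0 // andbT.
apply/negP => /eqP v0; move/negP: vn0; apply; apply/eqP; apply: b_nd => w.
rewrite fibre_pairingE (fibre_plus_minus vm) b0l add0r (fibre_minus_id vm).
set z := N w; have zm : z \in Cm by exact: memv_pi.
(* This is the sign of [b] on [v + t *: z]. Taking [t = b v z] if [b z z = 0], and the critical
   value [t = - b v z / b z z] otherwise, forces [b v z = 0]. *)
have h t : 2 * t * b v z + t ^+ 2 * b z z <= 0.
  have := @fibre_minus_le0 (v + t *: z) (memvD vm (memvZ _ zm)).
  rewrite bDl !bDr !bZl !bZr v0 [b z v]b_sym.
  rewrite /=; lra.
have q0 := fibre_minus_le0 zm.
have [q1|q1] := eqVneq (b z z) 0.
  have := h (b v z); rewrite q1 mulr0 addr0 => h1.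
  by apply/eqP; rewrite -sqrf_eq0 eq_le sqr_ge0 andbT; move: h1; nra.
have {q1}q0 : b z z < 0 by rewrite lt_neqAle q1.
have := h (- b v z / b z z); set p := b v z; set q := b z z in q0 *.
have -> : 2 * (- p / q) * p + (- p / q) ^+ 2 * q = - (p ^+ 2 / q).
  by field; rewrite lt_eqF.
rewrite oppr_le0 => h1; apply/eqP; rewrite -sqrf_eq0 eq_le sqr_ge0 andbT.
have qn0 : q != 0 by rewrite lt_eqF.
by rewrite -(divfK qn0 (p ^+ 2)) mulr_ge0_le0 // ltW.
Qed.

Fact fibre_metric_bilinear :
  bilinear_for *%R *%R (G : V -> V -> R).
Proof.
have PP k x y : P (k *: x + y) = k *: P x + P y by exact: linearP.
have NP k x y : N (k *: x + y) = k *: N x + N y by exact: linearP.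
by split=> [v|u] k x y; rewrite /= /G PP NP ?bDl ?bDr ?bZl ?bZr; ring.
Qed.

Lemma fibre_metric_posdef v : v != 0 -> 0 < G v v.
Proof.
move=> v0; rewrite /G subr_gt0.
have Pm : P v \in Cp by exact: memv_pi.
have Nm : N v \in Cm by exact: memv_pi.
have [Nv0|/(fibre_minus_lt0 Nm) Nv0] := eqVneq (N v) 0.
  rewrite Nv0 b0l; apply: b_max.1 => //.
  by apply: contra_neq v0 => Pv0; rewrite -(fibre_projD v) Pv0 Nv0 addr0.
apply: lt_le_trans Nv0 _; have [->|Pv0] := eqVneq (P v) 0; first by rewrite b0l.
exact/ltW/b_max.1.
Qed.

(** * Reflection along a Lagrangian subspace [L], with [H] the metric [G] as a bundled bilinear
    form *)

Section Reflection.
Variables (H : {biscalar V}) (L : {vspace V}).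
Hypothesis HE : forall u v, H u v = G u v.
Hypothesis L_iso : forall u v, u \in L -> v \in L -> b u v = 0.
Hypothesis L_coiso : forall v, (forall u, u \in L -> b u v = 0) -> v \in L.

Let T := orthogonal_complement H L.
Let C := daddv_pi T L - daddv_pi L T.
Let tau := P - N.

Lemma fibre_metric_nondegenerate U : nondegenerate_on H U.
Proof.
by apply: posdef_nondegenerate => v _ v0; rewrite HE; exact: fibre_metric_posdef.
Qed.

Lemma fibre_splitting_cap : (T :&: L)%VS = 0%VS.
Proof. by rewrite capvC orthogonal_cap //; exact: fibre_metric_nondegenerate. Qed.

Lemma fibre_splittingD v : daddv_pi T L v + daddv_pi L T v = v.
Proof.
apply: daddv_pi_add; first exact: fibre_splitting_cap.
by rewrite addvC orthogonal_add ?memvf //; exact: fibre_metric_nondegenerate.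
Qed.

Let tauE v : tau v = P v - N v.
Proof. by rewrite add_lfunE opp_lfunE. Qed.

Lemma fibre_reflectionE t l : t \in T -> l \in L -> C (t + l) = t - l.
Proof.
move=> tT lL; rewrite add_lfunE opp_lfunE !linearD /=.
have dT : daddv_pi T L t = t by exact: daddv_pi_id fibre_splitting_cap _.
have dL : daddv_pi L T l = l by rewrite daddv_pi_id // capvC fibre_splitting_cap.
have dT' : daddv_pi L T t = 0.
  by apply: (addrI t); rewrite addr0 -{1}dT fibre_splittingD.
have dL' : daddv_pi T L l = 0.
  by apply: (addIr l); rewrite add0r -{2}dL fibre_splittingD.
by rewrite dT dL dT' dL' addr0 ?oppr0 add0r.
Qed.

(** In this form both the smoothness of [C] and its compatibility with the anchor reduce to the
    projection to [L]. *)
Lemma fibre_reflection_subr v : C v = v - (daddv_pi L T v) *+ 2.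
Proof.
rewrite add_lfunE opp_lfunE -{3}(fibre_splittingD v) mulr2n opprD addrA.
by rewrite addrK.
Qed.

Let Ptau v : P (tau v) = P v.
Proof.
have Pm : P v \in Cp by exact: memv_pi.
have Nm : N v \in Cm by exact: memv_pi.
by rewrite tauE linearB /= (fibre_plus_id Pm) (fibre_plus_minus Nm) subr0.
Qed.

Let Ntau v : N (tau v) = - N v.
Proof.
have Pm : P v \in Cp by exact: memv_pi.
have Nm : N v \in Cm by exact: memv_pi.
by rewrite tauE linearB /= (fibre_minus_id Nm) (fibre_minus_plus Pm) sub0r.
Qed.

Let tauK v : tau (tau v) = v.
Proof. by rewrite tauE Ptau Ntau opprK fibre_projD. Qed.

(** Translates [H]-orthogonality into [b]-orthogonality, so that the hypotheses that [L] is
    Lagrangian for [b] can be used on [T]. *)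
Let H_tau u v : H u v = b u (tau v).
Proof. by rewrite HE fibre_pairingE Ptau Ntau [b _ (- _)]linearN. Qed.

(* [tau] exchanges the eigenspaces [T] and [L] of [C], whose eigenvalues are
   opposite. *)
Lemma fibre_reflection_tau v : C (tau v) = - tau (C v).
Proof.
set t := daddv_pi T L v; set l := daddv_pi L T v.
have tT : t \in T by exact: memv_pi.
have lL : l \in L by exact: memv_pi.
have vE : v = t + l by rewrite fibre_splittingD.
(* [tau] maps [T] into [L] because [L] contains its [b]-orthogonal, and [L] into [T] because [L] is
   isotropic and [tau] is an involution. *)
have taut : tau t \in L.
  by apply: L_coiso => u uL; rewrite -H_tau; move/orthogonal_complementP: tT; apply.
have taul : tau l \in T.
  apply/orthogonal_complementP => u uL; rewrite H_tau tauK; exact: L_iso.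
rewrite vE fibre_reflectionE // linearD addrC fibre_reflectionE //.
by rewrite linearB opprB.
Qed.

Let oppr_eq0 (w : V) : w = - w -> w = 0.
Proof.
move=> /eqP; rewrite -subr_eq0 opprK -mulr2n -scaler_nat scaler_eq0.
by rewrite pnatr_eq0 => /eqP.
Qed.

(** [tau] fixes [v], so anticommutation makes [C v] an eigenvector of [tau] for -1, and such vectors
    form [Cm]. *)
Lemma fibre_reflection_plus v : v \in Cp -> C v \in Cm.
Proof.
move=> vp; have := fibre_reflection_tau v.
have -> : tau v = v by rewrite tauE fibre_plus_id // fibre_minus_plus // subr0.
set w := C v; rewrite tauE opprB => h.
have P0 : P w = 0.
  by apply: oppr_eq0; apply: (addIr (N w)); rewrite fibre_projD addrC.
by rewrite -(fibre_projD w) P0 add0r memv_pi.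
Qed.

Lemma fibre_reflection_minus v : v \in Cm -> C v \in Cp.
Proof.
move=> vm; have := fibre_reflection_tau v.
have -> : tau v = - v by rewrite tauE fibre_minus_id // fibre_plus_minus // sub0r.
rewrite linearN => /oppr_inj; set w := C v; rewrite tauE => h.
have N0 : N w = 0.
  by apply: oppr_eq0; apply: (addrI (P w)); rewrite fibre_projD.
by rewrite -(fibre_projD w) N0 addr0 memv_pi.
Qed.

End Reflection.

End GeneralizedMetricFibre.

(** * Smooth sections *)

Section SmoothSections.
Context {R : realType} {n : nat} {M : smoothManifold R n}.
Variable V : framedFamily M.
Hypothesis hV : is_vector_bundle V.
Implicit Types (U : set M) (s t : section V) (f : M -> R).

Lemma frame_dom_open (a : frame_idx V) : open (frame_dom a).
Proof. by case: hV. Qed.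

Lemma frame_basis (a : frame_idx V) x : frame_dom a x -> basis_of fullv (frame a x).
Proof. by case: hV => _ _ h _; exact: h. Qed.

Lemma frame_coord (a : frame_idx V) x (v : V x) : frame_dom a x ->
  v = \sum_i coord (frame a x) i v *: tnth (frame a x) i.
Proof.
by move=> dx; exact: coord_basis_tnth (frame_basis dx) (memvf v).
Qed.

Lemma frame_smooth (a : frame_idx V) (i : 'I_(frame_rank a)) :
  smooth_section_on (frame_dom a) (fun x => tnth (frame a x) i).
Proof. by case: hV. Qed.

Lemma smooth_section_on_sub U U' s : U `<=` U' ->
  smooth_section_on U' s -> smooth_section_on U s.
Proof. by move=> UU' ss a i; apply: smooth_on_sub (ss a i) => x [dx /UU']. Qed.

Lemma smooth_section_on_local U s :
  (forall x, U x -> exists2 U', U' x & smooth_section_on U' s) ->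
  smooth_section_on U s.
Proof.
move=> h a i; apply: smooth_on_local => x [dx /h [U' U'x ss]].
by exists (frame_dom a `&` U').
Qed.

Lemma smooth_section_on_eq U s t : open U -> (forall x, U x -> s x = t x) ->
  smooth_section_on U s -> smooth_section_on U t.
Proof.
move=> oU st ss a i; apply: smooth_on_eq (ss a i).
  by apply: openI => //; exact: frame_dom_open.
by move=> x [_ Ux]; rewrite st.
Qed.

Lemma smooth_section_on0 U : smooth_section_on U (fun x => 0 : V x).
Proof.
move=> a i; under eq_fun do rewrite linear0.
exact: smooth_on_cst.
Qed.

Lemma smooth_section_onD U s t : open U ->
  smooth_section_on U s -> smooth_section_on U t ->
  smooth_section_on U (fun x => s x + t x).
Proof.
move=> oU ss st a i; under eq_fun do rewrite linearD.
have oI : open (frame_dom a `&` U) by apply: openI => //; exact: frame_dom_open.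
exact: smooth_onD oI (ss a i) (st a i).
Qed.

Lemma smooth_section_onZ U f s : open U -> smooth_on U f ->
  smooth_section_on U s -> smooth_section_on U (fun x => f x *: s x).
Proof.
move=> oU sf ss a i; under eq_fun do rewrite linearZ.
have oI : open (frame_dom a `&` U) by apply: openI => //; exact: frame_dom_open.
by apply: smooth_onM oI _ (ss a i); apply: smooth_on_sub sf => x [].
Qed.

Lemma smooth_section_onN U s : open U ->
  smooth_section_on U s -> smooth_section_on U (fun x => - s x).
Proof.
move=> oU ss; have -> : (fun x => - s x) = (fun x => (-1) *: s x).
  by apply: functional_extensionality_dep => x; rewrite scaleN1r.
by apply: smooth_section_onZ => //; exact: smooth_on_cst.
Qed.

Lemma smooth_section_on_sum U (I : Type) (r : seq I) (s : I -> section V) :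
  open U -> (forall i, smooth_section_on U (s i)) ->
  smooth_section_on U (fun x => \sum_(i <- r) s i x).
Proof.
move=> oU ss a i; under eq_fun do rewrite linear_sum.
apply: smooth_on_sum => [|j _]; last exact: ss.
by apply: openI => //; exact: frame_dom_open.
Qed.

Lemma smooth_section_cutoff U (K : set M) (chi : M -> R) s :
  open U -> smooth_fun chi -> closed K -> K `<=` U -> (forall x, ~ K x -> chi x = 0) ->
  smooth_section_on U s -> smooth_section (fun x => chi x *: s x).
Proof.
move=> oU schi cK KU chiK ss; apply: smooth_section_on_local => x _.
have [Kx|nKx] := pselect (K x).
  exists U; first exact: KU.
  by apply: smooth_section_onZ => //; exact: smooth_on_sub schi.
exists (~` K) => //; apply: smooth_section_on_eq (smooth_section_on0 _).
  exact: closed_openC.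
by move=> y /chiK ->; rewrite scale0r.
Qed.

(** * Gram matrices and smooth orthogonal projections *)

Section Forms.
Variable b : forall x, {biscalar (V x)}.
Arguments b : clear implicits.
Hypothesis sb : smooth_form (fun x => b x).

Lemma smooth_on_form U s t : open U ->
  smooth_section_on U s -> smooth_section_on U t ->
  smooth_on U (fun x => b x (s x) (t x)).
Proof.
move=> oU ss st; apply: smooth_on_local => x Ux.
have [a dx] : exists a : frame_idx V, frame_dom a x by case: hV.
have oW : open (frame_dom a `&` U) by apply: openI => //; exact: frame_dom_open.
exists (frame_dom a `&` U) => //.
have : smooth_on (frame_dom a `&` U) (fun y => \sum_i \sum_j
   coord (frame a y) i (s y) * (coord (frame a y) j (t y)
    * b y (tnth (frame a y) i) (tnth (frame a y) j))).
  apply: smooth_on_sum => // i _; apply: smooth_on_sum => // j _.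
  apply: smooth_onM => //; apply: smooth_onM => //.
  by apply: smooth_on_sub (sb i j) => y [].
apply: smooth_on_eq => // y [dy _].
rewrite [in RHS](frame_coord (s y) dy) linear_sumlz; apply: eq_bigr => i _.
rewrite [in RHS](frame_coord (t y) dy) linear_sumr; apply: eq_bigr => j _.
by rewrite [RHS]linearZl_LR [in RHS]linearZr_LR.
Qed.

Lemma smooth_on_det U r (A : M -> 'M[R]_r) : open U ->
  (forall i j, smooth_on U (fun x => A x i j)) -> smooth_on U (fun x => \det (A x)).
Proof.
move=> oU sA; apply: smooth_on_sum => // p _; apply: smooth_onM => //.
  exact: smooth_on_cst.
by apply: smooth_on_prod => // i _; exact: sA.
Qed.

(** Cramer's rule: entries of the inverse are cofactors over a nonvanishing determinant. The
    cofactor indices are swapped because the adjugate is a transpose. *)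
Lemma smooth_on_invmx U r (A : M -> 'M[R]_r) i j : open U ->
  (forall i j, smooth_on U (fun x => A x i j)) ->
  (forall x, U x -> A x \in unitmx) -> smooth_on U (fun x => invmx (A x) i j).
Proof.
move=> oU sA uA.
have : smooth_on U (fun x => (\det (A x))^-1 *
    ((-1) ^+ (j + i) * \det (row' j (col' i (A x))))).
  apply: smooth_onM => //.
    apply: smooth_onV => //; last exact: smooth_on_det.
    by move=> x /uA; rewrite unitmxE unitfE.
  apply: smooth_onM => //; first exact: smooth_on_cst.
  apply: smooth_on_det => // k l; under eq_fun do rewrite !mxE.
  exact: sA.
by apply: smooth_on_eq => // x Ux; rewrite /invmx uA // !mxE.
Qed.

(* The coordinates of [p] in a local frame [e] of [C] solve the linear system
   whose matrix is the Gram matrix of [e]. *)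
Lemma smooth_on_dual U r (e : forall x, r.-tuple (V x)) (C : forall x, {vspace V x})
    (p : section V) : open U ->
  (forall x, U x -> basis_of (C x) (e x)) ->
  (forall i : 'I_r, smooth_section_on U (fun x => tnth (e x) i)) ->
  (forall x, U x -> nondegenerate_on (b x) (C x)) ->
  (forall x, U x -> p x \in C x) ->
  (forall i : 'I_r, smooth_on U (fun x => b x (tnth (e x) i) (p x))) ->
  smooth_section_on U p.
Proof.
move=> oU eC se nd pC sp.
pose g x := gram (b x) (e x).
have ug x : U x -> g x \in unitmx.
  by move=> Ux; apply: gram_unit (eC x Ux) (nd x Ux).
have sg i j : smooth_on U (fun x => g x i j).
  by under eq_fun do rewrite mxE; exact: smooth_on_form.
have := smooth_section_on_sum (index_enum 'I_r) oU
  (fun i => smooth_section_onZ oU (smooth_on_sum (index_enum 'I_r) (P := xpredT) oU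
    (fun j _ => smooth_onM oU (smooth_on_invmx i j oU sg ug) (sp j))) (se i)).
apply: smooth_section_on_eq => // x Ux.
rewrite [RHS](coord_basis_tnth (eC x Ux) (pC x Ux)).
apply: eq_bigr => i _; congr (_ *: _).
pose c := \col_i coord (e x) i (p x).
have gc : g x *m c = \col_i b x (tnth (e x) i) (p x).
  apply/colP => j; rewrite gram_mul mxE [in RHS](coord_basis_tnth (eC x Ux) (pC x Ux)).
  by congr (b x _ _); apply: eq_bigr => k _; rewrite mxE.
have : invmx (g x) *m (g x *m c) = c by rewrite mulKmx // ug.
move=> /colP /(_ i); rewrite gc !mxE => <-; apply: eq_bigr => j _.
by rewrite !mxE.
Qed.

(** A frame vector of [C] pairs with the projection of [s] as it does with [s] itself, which is a
    smooth function; [smooth_on_dual] then applies. *)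
Lemma smooth_on_orthogonal_proj U (C : forall x, {vspace V x}) s : open U ->
  is_subbundle C -> (forall x, nondegenerate_on (b x) (C x)) ->
  smooth_section_on U s ->
  smooth_section_on U
    (fun x => daddv_pi (C x) (orthogonal_complement (b x) (C x)) (s x)).
Proof.
move=> oU hC nd ss; apply: smooth_section_on_local => x Ux.
have [U' [r [e [oU' U'x eC se]]]] := hC x.
have oW : open (U `&` U') by exact: openI.
exists (U `&` U') => //; apply: (@smooth_on_dual _ r e C) => //.
- by move=> y [_]; exact: eC.
- by move=> i; apply: smooth_section_on_sub (se i) => y [].
- by move=> y _; exact: memv_pi.
move=> i; have : smooth_on (U `&` U') (fun y => b y (tnth (e y) i) (s y)).
  apply: smooth_on_form => //; first by apply: smooth_section_on_sub (se i) => y [].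
  by apply: smooth_section_on_sub ss => y [].
apply: smooth_on_eq => // y [_ U'y].
set C' := orthogonal_complement _ _.
have eD : daddv_pi (C y) C' (s y) + daddv_pi C' (C y) (s y) = s y.
  by apply: daddv_pi_add; rewrite ?orthogonal_cap ?orthogonal_add ?memvf //; exact: nd.
have /orthogonal_complementP ort : daddv_pi C' (C y) (s y) \in C' by exact: memv_pi.
rewrite -[in LHS]eD linearDr ort ?addr0 //.
exact: basis_mem (eC y U'y) (mem_tnth _ _).
Qed.

End Forms.
End SmoothSections.

(** * The operator D *)

Section MetricOperator.
Context {R : realType} {n : nat} {M : smoothManifold R n}.
Context {E : framedFamily M}.
Variable A : exactCourant E.
Implicit Types (f : M -> R) (a b Z W : section E).

Let hE : is_vector_bundle E := courant_bundle A.

Lemma smooth_pairing a b : smooth_section a -> smooth_section b ->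
  smooth_fun (fun y => pairing A y (a y) (b y)).
Proof.
move=> sa sb;
exact: (smooth_on_form (b := pairing A) hE (pairing_smooth A) openT sa sb).
Qed.

Lemma smooth_sectionP k a b : smooth_section a -> smooth_section b ->
  smooth_section (fun y => k *: a y + b y).
Proof.
move=> sa sb; have sk : smooth_section_on setT (fun y => k *: a y).
  exact: (smooth_section_onZ hE openT (smooth_on_cst _ k) sa).
exact: (smooth_section_onD hE openT sk sb).
Qed.

(* Polarisation of [bracket_diag]. *)
Lemma bracket_skew a b x : smooth_section a -> smooth_section b ->
  (forall y, pairing A y (a y) (b y) = 0) ->
  bracket A a b x = - bracket A b a x.
Proof.
move=> sa sb ab0; have sc := smooth_sectionP 1 sa sb.
have := bracket_diag A sc x.
have -> : (fun y => pairing A y (1 *: a y + b y) (1 *: a y + b y)) =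
    (fun y => pairing A y (a y) (a y) + pairing A y (b y) (b y)).
  apply/funext => y; rewrite scale1r linearDl !linearDr /= ab0.
  by rewrite [pairing A y (b y) (a y)]pairing_sym ab0 addr0 add0r.
have saa := smooth_pairing sa sa; have sbb := smooth_pairing sb sb.
rewrite (differentialD x saa sbb) linearD scalerDr /=.
move=> h; have {h} := etrans h (esym (congr2 +%R (bracket_diag A sa x) (bracket_diag A sb x))).
rewrite (bracket_linearl A 1 sa sb sc) !(bracket_linearr A 1 _ sa sb) // !scale1r.
rewrite -addrA => /addrI; rewrite addrA -[RHS]add0r => /addIr h.
by apply/eqP; rewrite -subr_eq0 opprK h.
Qed.

Lemma bracket_scalel f a b x : smooth_fun f -> smooth_section a -> smooth_section b ->
  (forall y, pairing A y (a y) (b y) = 0) ->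
  bracket A (fun y => f y *: a y) b x =
  f x *: bracket A a b x - (differential f x (anchor A x (b x)) : R) *: a x.
Proof.
move=> sf sa sb ab0.
have sfa : smooth_section (fun y => f y *: a y).
  exact: (smooth_section_onZ hE openT sf sa).
rewrite (bracket_skew x sfa sb); last first.
  by move=> y; rewrite linearZl_LR ab0 mulr0.
by rewrite (bracket_leibniz A sf sb sa) (bracket_skew x sa sb ab0) scalerN opprD.
Qed.

(** * The common shape of the four summands *)

Section Term.
Variables Q L1 L2 : forall x, {linear E x -> E x}.
Arguments Q : clear implicits.
Arguments L1 : clear implicits.
Arguments L2 : clear implicits.
Hypothesis sL1 : forall Z, smooth_section Z -> smooth_section (fun x => L1 x (Z x)).
Hypothesis sL2 : forall Z, smooth_section Z -> smooth_section (fun x => L2 x (Z x)).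

(** [L1] is a general fibrewise linear map, since the first argument may be a projection followed by
    [C]. *)
Definition bracket_term Z W : section E := fun x =>
  Q x (bracket A (fun y => L1 y (Z y)) (fun y => L2 y (W y)) x).

Lemma bracket_term_linearl k Z Z' W x :
  smooth_section Z -> smooth_section Z' -> smooth_section W ->
  bracket_term (fun y => k *: Z y + Z' y) W x =
  k *: bracket_term Z W x + bracket_term Z' W x.
Proof.
move=> sZ sZ' sW; rewrite /bracket_term -linearP; congr (Q x _).
rewrite -(bracket_linearl A k (sL1 sZ) (sL1 sZ') (sL2 sW)).
by congr (bracket A _ _ x); apply: functional_extensionality_dep => y; rewrite linearP.
Qed.

Lemma bracket_term_linearr k Z W W' x :
  smooth_section Z -> smooth_section W -> smooth_section W' ->
  bracket_term Z (fun y => k *: W y + W' y) x =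
  k *: bracket_term Z W x + bracket_term Z W' x.
Proof.
move=> sZ sW sW'; rewrite /bracket_term -linearP; congr (Q x _).
rewrite -(bracket_linearr A k (sL1 sZ) (sL2 sW) (sL2 sW')).
by congr (bracket A _ _ x); apply: functional_extensionality_dep => y; rewrite linearP.
Qed.

Lemma bracket_term_scalel f Z W x :
  smooth_fun f -> smooth_section Z -> smooth_section W ->
  (forall y u v, pairing A y (L1 y u) (L2 y v) = 0) ->
  (forall y u, Q y (L1 y u) = 0) ->
  bracket_term (fun y => f y *: Z y) W x = f x *: bracket_term Z W x.
Proof.
move=> sf sZ sW orth QL1; rewrite /bracket_term.
have -> : (fun y => L1 y (f y *: Z y)) = (fun y => f y *: L1 y (Z y)).
  by apply: functional_extensionality_dep => y; rewrite linearZ.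
rewrite (bracket_scalel x sf (sL1 sZ) (sL2 sW) (fun y => orth y _ _)).
by rewrite linearB !linearZ /= QL1 oppr0 scaler0 addr0.
Qed.

Lemma bracket_term_leibniz f Z W x :
  smooth_fun f -> smooth_section Z -> smooth_section W ->
  bracket_term Z (fun y => f y *: W y) x = f x *: bracket_term Z W x
    + (differential f x (anchor A x (L1 x (Z x))) : R) *: Q x (L2 x (W x)).
Proof.
move=> sf sZ sW; rewrite /bracket_term.
have -> : (fun y => L2 y (f y *: W y)) = (fun y => f y *: L2 y (W y)).
  by apply: functional_extensionality_dep => y; rewrite linearZ.
by rewrite (bracket_leibniz A sf (sL1 sZ) (sL2 sW)) linearD !linearZ.
Qed.

End Term.


(** * Smoothness of the projections and of [C], and the properties of the operator on sections *)

Section WithMetric.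
Variable Cp : forall x, {vspace E x}.
Hypothesis hCp : generalized_metric A Cp.
Local Notation P x := (proj_plus A Cp x).
Local Notation N x := (proj_minus A Cp x).
Local Notation C x := (Cmap A Cp x).
Local Notation Cm x := (Cminus A Cp x).
Local Notation G := (Gmetric A Cp).

Let sym x := @pairing_sym R n M E A x.
Let nd x := @pairing_nondegenerate R n M E A x.
Let mx x := hCp.2 x.

(** [G] with its bilinear structure attached, so that the results on orthogonal projections apply to
    it as well as to the pairing. *)
Definition metric_form x : {biscalar E x} := HB.pack (Gmetric A Cp (x := x))
  (bilinear_isBilinear.Build R (E x) (E x) R *%R *%R (Gmetric A Cp (x := x))
    (fibre_metric_bilinear (pairing A x) (Cp x))).

Lemma proj_plus_minusD x v : P x v + N x v = v.
Proof. exact: fibre_projD (mx x) v. Qed.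

Lemma cotangent_isotropic x u v :
  u \in cotangent_in A x -> v \in cotangent_in A x -> pairing A x u v = 0.
Proof.
move=> /memv_imgP [xi _ ->]; rewrite /cotangent_in courant_exact memv_ker => /eqP v0.
by rewrite pairing_coanchor v0 linear0.
Qed.

(** Pairing [v] with the images of the coordinate forms of a basis of the tangent space yields the
    coordinates of its anchor; these vanish, and exactness concludes. *)
Lemma cotangent_coisotropic x v :
  (forall u, u \in cotangent_in A x -> pairing A x u v = 0) -> v \in cotangent_in A x.
Proof.
move=> h; rewrite /cotangent_in courant_exact memv_ker; apply/eqP.
rewrite [LHS](coord_vbasis (memvf _)) big1 // => i _.
set X := vbasis _; pose xi : cotangent M x := linfun (coord X i : tangent M x -> R^o).
have xiE : xi (anchor A x v) = coord X i (anchor A x v) by rewrite lfunE.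
rewrite -xiE -pairing_coanchor h ?scale0r //.
by apply: memv_img; exact: memvf.
Qed.

Let HE x u v : metric_form x u v = pairing A x (P x u) (P x v) - pairing A x (N x u) (N x v).
Proof. by []. Qed.

Lemma Cmap_plus x v : v \in Cp x -> C x v \in Cm x.
Proof.
exact: (fibre_reflection_plus (@sym x) (@nd x) (mx x) (H := metric_form x)
  (@HE x) (@cotangent_isotropic x) (@cotangent_coisotropic x)).
Qed.

Lemma Cmap_minus x v : v \in Cm x -> C x v \in Cp x.
Proof.
exact: (fibre_reflection_minus (@sym x) (@nd x) (mx x) (H := metric_form x)
  (@HE x) (@cotangent_isotropic x) (@cotangent_coisotropic x)).
Qed.

Lemma CmapE x v :
  C x v = v - (daddv_pi (cotangent_in A x) (tangent_in A Cp x) v) *+ 2.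
Proof.
exact: (fibre_reflection_subr (@sym x) (@nd x) (mx x) (H := metric_form x)
  (cotangent_in A x) (@HE x) v).
Qed.

(** [C v] differs from [v] by twice its cotangent part, which the anchor kills. *)
Lemma anchor_Cmap x v : anchor A x (C x v) = anchor A x v.
Proof.
rewrite CmapE linearB linearMn /=.
have : daddv_pi (cotangent_in A x) (tangent_in A Cp x) v \in lker (anchor A x).
  by rewrite -courant_exact; exact: memv_pi.
by rewrite memv_ker => /eqP ->; rewrite mul0rn subr0.
Qed.

Lemma smooth_plus U Z : open U ->
  smooth_section_on U Z -> smooth_section_on U (fun x => P x (Z x)).
Proof.
move=> oU sZ; apply: (smooth_on_orthogonal_proj hE (b := pairing A)) => //.
- exact: pairing_smooth.
- by case: hCp.
- by move=> x; exact/posdef_nondegenerate/(mx x).1.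
Qed.

(** Only [Cp] comes with smooth local frames, so this projection is handled as the identity minus
    the other one. *)
Lemma smooth_minus U Z : open U ->
  smooth_section_on U Z -> smooth_section_on U (fun x => N x (Z x)).
Proof.
move=> oU sZ.
have := smooth_section_onD hE oU sZ (smooth_section_onN hE oU (smooth_plus oU sZ)).
apply: (smooth_section_on_eq hE oU) => x _.
by rewrite -{1}(proj_plus_minusD (Z x)) addrAC subrr add0r.
Qed.

Lemma metric_form_smooth : smooth_form (fun x => metric_form x).
Proof.
move=> a i j; have oa := frame_dom_open hE a.
have si := frame_smooth hE i; have sj := frame_smooth hE j.
have sp := smooth_on_form hE (pairing_smooth A) oa (smooth_plus oa si) (smooth_plus oa sj).
have sm := smooth_on_form hE (pairing_smooth A) oa (smooth_minus oa si) (smooth_minus oa sj).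
exact: (smooth_onD oa sp (smooth_onN oa sm)).
Qed.

Lemma cotangent_subbundle : is_subbundle (cotangent_in A).
Proof.
move=> x; exists (chart_dom (chart_at x)), n,
  (fun y => map_tuple (coanchor A y) [tuple coord_form (chart_at x) k y | k < n]).
split; [exact: chart_dom_open|exact: chart_atP| |].
- move=> y dy; apply: limg_basis_of; last exact: (coord_form_basis dy).
  by rewrite coanchor_inj capv0.
- move=> i; have := @coanchor_smooth R n M E A (chart_at x) i.
  apply: (smooth_section_on_eq hE (chart_dom_open _)) => y _.
  by rewrite [RHS]tnth_map.
Qed.

(** The pairing vanishes on the cotangent part and has zero Gram matrices there; the projection is
    instead orthogonal for [G], whose Gram matrices are invertible. *)
Lemma smooth_Cmap Z : smooth_section Z -> smooth_section (fun x => C x (Z x)).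
Proof.
move=> sZ.
have sL : smooth_section (fun x => daddv_pi (cotangent_in A x) (tangent_in A Cp x) (Z x)).
  have ndL x := fibre_metric_nondegenerate (@sym x) (@nd x) (mx x) (@HE x)
    (U := cotangent_in A x).
  exact: (smooth_on_orthogonal_proj hE (b := metric_form) metric_form_smooth openT
    cotangent_subbundle ndL sZ).
have := smooth_section_onD hE openT sZ (smooth_section_onN hE openT
  (smooth_section_onD hE openT sL sL)).
by apply: (smooth_section_on_eq hE openT) => x _; rewrite CmapE mulr2n.
Qed.

Lemma plus_minus x v : P x (N x v) = 0.
Proof. apply: (fibre_plus_minus (mx x)); exact: memv_pi. Qed.

Lemma minus_plus x v : N x (P x v) = 0.
Proof. apply: (fibre_minus_plus (mx x)); exact: memv_pi. Qed.

Lemma plus_id x v : v \in Cp x -> P x v = v.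
Proof. exact: fibre_plus_id (mx x) v. Qed.

Lemma minus_id x v : v \in Cm x -> N x v = v.
Proof. exact: fibre_minus_id (mx x) v. Qed.

Lemma plus_orth x u v : u \in Cp x -> v \in Cm x -> pairing A x u v = 0.
Proof. exact: fibre_orth. Qed.

Lemma mem_plus x v : P x v \in Cp x. Proof. exact: memv_pi. Qed.
Lemma mem_minus x v : N x v \in Cm x. Proof. exact: memv_pi. Qed.

Let Pl x : {linear E x -> E x} := P x.
Let Nl x : {linear E x -> E x} := N x.
Let CPl x : {linear E x -> E x} := (C x : _ -> _) \o P x.
Let CNl x : {linear E x -> E x} := (C x : _ -> _) \o N x.

Let sP Z : smooth_section Z -> smooth_section (fun x => Pl x (Z x)).
Proof. exact: smooth_plus openT. Qed.
Let sN Z : smooth_section Z -> smooth_section (fun x => Nl x (Z x)).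
Proof. exact: smooth_minus openT. Qed.
Let sCP Z : smooth_section Z -> smooth_section (fun x => CPl x (Z x)).
Proof. by move=> sZ; exact: smooth_Cmap (sP sZ). Qed.
Let sCN Z : smooth_section Z -> smooth_section (fun x => CNl x (Z x)).
Proof. by move=> sZ; exact: smooth_Cmap (sN sZ). Qed.

Lemma metric_operatorE Z W x : metric_operator A Cp Z W x =
  bracket_term Pl Nl Pl Z W x + bracket_term Nl Pl Nl Z W x
  + bracket_term Nl CNl Nl Z W x + bracket_term Pl CPl Pl Z W x.
Proof. by []. Qed.

Lemma metric_operator_linearl k Z Z' W x :
  smooth_section Z -> smooth_section Z' -> smooth_section W ->
  metric_operator A Cp (fun y => k *: Z y + Z' y) W x =
  k *: metric_operator A Cp Z W x + metric_operator A Cp Z' W x.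
Proof.
move=> sZ sZ' sW; rewrite !metric_operatorE.
rewrite (bracket_term_linearl Pl sN sP k x sZ sZ' sW).
rewrite (bracket_term_linearl Nl sP sN k x sZ sZ' sW).
rewrite (bracket_term_linearl Nl sCN sN k x sZ sZ' sW).
rewrite (bracket_term_linearl Pl sCP sP k x sZ sZ' sW).
by rewrite !scalerDr [RHS]addrACA [X in _ = X + _]addrACA [X in _ = X + _ + _]addrACA.
Qed.

Lemma metric_operator_linearr k Z W W' x :
  smooth_section Z -> smooth_section W -> smooth_section W' ->
  metric_operator A Cp Z (fun y => k *: W y + W' y) x =
  k *: metric_operator A Cp Z W x + metric_operator A Cp Z W' x.
Proof.
move=> sZ sW sW'; rewrite !metric_operatorE.
rewrite (bracket_term_linearr Pl sN sP k x sZ sW sW').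
rewrite (bracket_term_linearr Nl sP sN k x sZ sW sW').
rewrite (bracket_term_linearr Nl sCN sN k x sZ sW sW').
rewrite (bracket_term_linearr Pl sCP sP k x sZ sW sW').
by rewrite !scalerDr [RHS]addrACA [X in _ = X + _]addrACA [X in _ = X + _ + _]addrACA.
Qed.

Lemma metric_operator_scalel f Z W x :
  smooth_fun f -> smooth_section Z -> smooth_section W ->
  metric_operator A Cp (fun y => f y *: Z y) W x = f x *: metric_operator A Cp Z W x.
Proof.
move=> sf sZ sW; rewrite !metric_operatorE.
have oNP y u v : pairing A y (N y u) (P y v) = 0.
  by rewrite pairing_sym; apply: plus_orth; [exact: mem_plus|exact: mem_minus].
have oPN y u v : pairing A y (P y u) (N y v) = 0 by rewrite pairing_sym oNP.
have oCN y u v : pairing A y (C y (N y u)) (N y v) = 0.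
  by apply: plus_orth; [exact/Cmap_minus/mem_minus|exact: mem_minus].
have oCP y u v : pairing A y (C y (P y u)) (P y v) = 0.
  by rewrite pairing_sym; apply: plus_orth; [exact: mem_plus|exact/Cmap_plus/mem_plus].
have NCN y u : N y (C y (N y u)) = 0.
  exact: (fibre_minus_plus (mx y) (Cmap_minus (mem_minus u))).
have PCP y u : P y (C y (P y u)) = 0.
  exact: (fibre_plus_minus (mx y) (Cmap_plus (mem_plus u))).
rewrite (bracket_term_scalel (Q := Pl) sN sP x sf sZ sW oNP plus_minus).
rewrite (bracket_term_scalel (Q := Nl) sP sN x sf sZ sW oPN minus_plus).
rewrite (bracket_term_scalel (Q := Nl) sCN sN x sf sZ sW oCN NCN).
rewrite (bracket_term_scalel (Q := Pl) sCP sP x sf sZ sW oCP PCP).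
by rewrite !scalerDr.
Qed.

Lemma plus_plus x v : P x (P x v) = P x v.
Proof. exact/plus_id/mem_plus. Qed.

Lemma minus_minus x v : N x (N x v) = N x v.
Proof. exact/minus_id/mem_minus. Qed.

Lemma anchor_projD x v : anchor A x (N x v) + anchor A x (P x v) = anchor A x v.
Proof. by rewrite -linearD addrC proj_plus_minusD. Qed.

Lemma metric_operator_leibniz f Z W x :
  smooth_fun f -> smooth_section Z -> smooth_section W ->
  metric_operator A Cp Z (fun y => f y *: W y) x = f x *: metric_operator A Cp Z W x
    + (differential f x (anchor A x (Z x)) : R) *: W x.
Proof.
move=> sf sZ sW; rewrite !metric_operatorE.
rewrite (bracket_term_leibniz Pl sN sP x sf sZ sW).
rewrite (bracket_term_leibniz Nl sP sN x sf sZ sW).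
rewrite (bracket_term_leibniz Nl sCN sN x sf sZ sW).
rewrite (bracket_term_leibniz Pl sCP sP x sf sZ sW).
rewrite /= !anchor_Cmap !plus_plus !minus_minus.
set dn : R := differential f x (anchor A x (N x (Z x))).
set dp : R := differential f x (anchor A x (P x (Z x))).
have -> : (differential f x (anchor A x (Z x)) : R) = dn + dp.
  by rewrite -(anchor_projD (Z x)) linearD.
(* [W_+] is differentiated along [Z_-] by the first summand and along [C Z_+] by the fourth, [W_-]
   along [Z_+] by the second and along [C Z_-] by the third. *)
have -> : (dn + dp) *: W x = dn *: P x (W x) + dp *: N x (W x)
    + dn *: N x (W x) + dp *: P x (W x).
  rewrite -{1}(proj_plus_minusD (W x)) scalerDl !scalerDr -!addrA; congr (_ + _).
  by rewrite addrCA [dp *: P x _ + _]addrC.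
by rewrite !scalerDr [RHS]addrACA [X in _ = X + _]addrACA [X in _ = X + _ + _]addrACA.
Qed.

Lemma smooth_metric_operator Z W : smooth_section Z -> smooth_section W ->
  smooth_section (metric_operator A Cp Z W).
Proof.
move=> sZ sW.
have st (Q L1 L2 : forall x, {linear E x -> E x}) :
    (forall Y, smooth_section Y -> smooth_section (fun x => Q x (Y x))) ->
    (forall Y, smooth_section Y -> smooth_section (fun x => L1 x (Y x))) ->
    (forall Y, smooth_section Y -> smooth_section (fun x => L2 x (Y x))) ->
    smooth_section (bracket_term Q L1 L2 Z W).
  by move=> sQ sL1 sL2; exact: sQ (bracket_smooth A (sL1 _ sZ) (sL2 _ sW)).
have s1 := st Pl Nl Pl sP sN sP; have s2 := st Nl Pl Nl sN sP sN.
have s3 := st Nl CNl Nl sN sCN sN; have s4 := st Pl CPl Pl sP sCP sP.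
exact: (smooth_section_onD hE openT (smooth_section_onD hE openT
  (smooth_section_onD hE openT s1 s2) s3) s4).
Qed.

Lemma plus_metric_operator Z W x : P x (metric_operator A Cp Z W x) =
  P x (bracket A (sec_minus A Cp Z) (sec_plus A Cp W) x
       + bracket A (sec_C A Cp (sec_plus A Cp Z)) (sec_plus A Cp W) x).
Proof.
rewrite /metric_operator {1 4}/sec_plus {2 4}/sec_minus !linearD /=.
by rewrite !plus_plus !plus_minus !addr0.
Qed.

Lemma minus_metric_operator Z W x : N x (metric_operator A Cp Z W x) =
  N x (bracket A (sec_plus A Cp Z) (sec_minus A Cp W) x
       + bracket A (sec_C A Cp (sec_minus A Cp Z)) (sec_minus A Cp W) x).
Proof.
rewrite /metric_operator {1 4}/sec_plus {2 4}/sec_minus !linearD /=.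
by rewrite !minus_minus !minus_plus add0r addr0.
Qed.

Let pairing_plus x u v : pairing A x (P x u) (P x v) = pairing A x u (P x v).
Proof.
rewrite -{2}(proj_plus_minusD u) linearDl /= [X in _ + X]pairing_sym.
by rewrite (plus_orth (mem_plus v) (mem_minus u)) addr0.
Qed.

Let pairing_minus x u v : pairing A x (N x u) (N x v) = pairing A x u (N x v).
Proof.
by rewrite -{2}(proj_plus_minusD u) linearDl /= (plus_orth (mem_plus u) (mem_minus v)) add0r.
Qed.

Lemma preserves_plus Z s t x :
  smooth_section Z -> smooth_section s -> smooth_section t ->
  differential (fun y => pairing A y (P y (s y)) (P y (t y))) x (anchor A x (Z x))
  = pairing A x (P x (metric_operator A Cp Z s x)) (P x (t x))
    + pairing A x (P x (s x)) (P x (metric_operator A Cp Z t x)).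
Proof.
move=> sZ ss st; rewrite -(anchor_projD (Z x)) linearD /=.
rewrite -[anchor A x (P x (Z x))]anchor_Cmap.
have h1 := bracket_pairing A (sN sZ) (sP ss) (sP st) x.
have h2 := bracket_pairing A (sCP sZ) (sP ss) (sP st) x.
rewrite !plus_metric_operator [pairing A x (P x (s x)) _]pairing_sym !pairing_plus.
rewrite !linearDl /= ![pairing A x _ (P x (s x))]pairing_sym addrACA.
exact: (congr2 (fun u v : R => u + v) h1 h2).
Qed.

Lemma preserves_minus Z s t x :
  smooth_section Z -> smooth_section s -> smooth_section t ->
  differential (fun y => pairing A y (N y (s y)) (N y (t y))) x (anchor A x (Z x))
  = pairing A x (N x (metric_operator A Cp Z s x)) (N x (t x))
    + pairing A x (N x (s x)) (N x (metric_operator A Cp Z t x)).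
Proof.
move=> sZ ss st; rewrite -(anchor_projD (Z x)) addrC linearD /=.
rewrite -[anchor A x (N x (Z x))]anchor_Cmap.
have h1 := bracket_pairing A (sP sZ) (sN ss) (sN st) x.
have h2 := bracket_pairing A (sCN sZ) (sN ss) (sN st) x.
rewrite !minus_metric_operator [pairing A x (N x (s x)) _]pairing_sym !pairing_minus.
rewrite !linearDl /= ![pairing A x _ (N x (s x))]pairing_sym addrACA.
exact: (congr2 (fun u v : R => u + v) h1 h2).
Qed.

Lemma metric_operator_pairing Z s t x :
  smooth_section Z -> smooth_section s -> smooth_section t ->
  differential (fun y => pairing A y (s y) (t y)) x (anchor A x (Z x))
  = pairing A x (metric_operator A Cp Z s x) (t x)
    + pairing A x (s x) (metric_operator A Cp Z t x).
Proof.
move=> sZ ss st.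
have pE y u v : pairing A y u v =
    pairing A y (P y u) (P y v) + pairing A y (N y u) (N y v).
  exact: fibre_pairingE (@sym y) (mx y) u v.
have -> : (fun y => pairing A y (s y) (t y)) = (fun y =>
    pairing A y (P y (s y)) (P y (t y)) + pairing A y (N y (s y)) (N y (t y))).
  by apply/funext => y; exact: pE.
have hp := smooth_pairing (sP ss) (sP st); have hm := smooth_pairing (sN ss) (sN st).
rewrite (differentialD x hp hm) add_lfunE.
rewrite (pE x _ (t x)) (pE x (s x)) addrACA.
exact: (congr2 (fun u v : R => u + v)
  (preserves_plus x sZ ss st) (preserves_minus x sZ ss st)).
Qed.

(** The pairing is the sum, and [G] the difference, of the same two forms on [C_+] and [C_-], each
    of which is preserved. *)
Lemma metric_operator_metric Z s t x :
  smooth_section Z -> smooth_section s -> smooth_section t ->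
  differential (fun y => G (s y) (t y)) x (anchor A x (Z x))
  = G (metric_operator A Cp Z s x) (t x) + G (s x) (metric_operator A Cp Z t x).
Proof.
move=> sZ ss st; rewrite /Gmetric.
have hp := smooth_pairing (sP ss) (sP st); have hm := smooth_pairing (sN ss) (sN st).
rewrite (differentialD x hp (smooth_onN openT hm)) (differentialN x hm).
rewrite add_lfunE opp_lfunE addrACA -opprD.
exact: (congr2 (fun u v : R => u - v)
  (preserves_plus x sZ ss st) (preserves_minus x sZ ss st)).
Qed.

End WithMetric.

End MetricOperator.

(** * Tensoriality and the generalized connection *)

Section TensorSpaces.
Context {R : realType}.
Implicit Types A B : vectType R.

(** Evaluates [linfun] on functions whose linearity is a proved fact, such as [D_v W] as a function
    of [v], linear by tensoriality. *)
Lemma linear_linfunE A B (f : A -> B) : linear f -> forall v, linfun f v = f v.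
Proof.
move=> lf v; pose fM := GRing.isLinear.Build _ _ _ _ _ lf.
pose fL : {linear A -> B} := HB.pack f fM.
exact: (lfunE fL).
Qed.

Lemma pure_tensorE A B (a : A) (b : B) alpha :
  pure_tensor a b alpha = (alpha a : R) *: b.
Proof.
apply: (linear_linfunE (f := fun al : 'Hom(A, R^o) => (al a : R) *: b)) => k u v.
by rewrite add_lfunE scale_lfunE scalerDl scalerA.
Qed.

(** Row-major enumeration: the pair of indices is the quotient and remainder by the length of the
    second list. *)
Lemma nth_allpairs S T U (f : S -> T -> U) s t x0 y0 z0 k :
  (k < size s * size t)%N ->
  nth z0 (allpairs f s t) k =
  f (nth x0 s (k %/ size t)) (nth y0 t (k %% size t)).
Proof.
elim: s k => [|x s IH] k //; rewrite [size (x :: s)]/= mulSn => hk.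
have t0 : (0 < size t)%N by case: (size t) hk => //; rewrite muln0.
have -> : allpairs f (x :: s) t = map (f x) t ++ allpairs f s t by [].
rewrite nth_cat size_map; case: ltnP => [kt|tk].
  by rewrite (nth_map y0) // divn_small // modn_small.
rewrite IH; last by rewrite ltn_subLR.
have kE : k = (1 * size t + (k - size t))%N by rewrite mul1n subnKC.
by rewrite [in RHS]kE divnMDl // modnMDl.
Qed.

Lemma dual_dim A : dim 'Hom(A, R^o) = dim A.
Proof. by rewrite -[RHS]muln1. Qed.

Lemma hom_dim A B : dim 'Hom(A, B) = (dim A * dim B)%N.
Proof. by []. Qed.

(** Evaluation on the [i]-th dual vector followed by the [j]-th coordinate isolates one coefficient.
    As [c] is arbitrary, this yields both the freeness of the pure tensors and their coordinates. *)
Lemma tensor_coord_sum A B rA rB (X : rA.-tuple A) (Y : rB.-tuple B)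
    (XY := allpairs_tuple (@pure_tensor R A B) X Y)
    (k : 'I_(rA * rB)) (i : 'I_rA) (j : 'I_rB) (c : 'I_(rA * rB) -> R) :
  free X -> free Y -> k = (i * rB + j)%N :> nat ->
  coord Y j ((\sum_l c l *: XY`_l) (linfun (coord X i : A -> R^o))) = c k.
Proof.
move=> fX fY kE; have rB0 : (0 < rB)%N by exact: leq_ltn_trans (leq0n j) (ltn_ord j).
rewrite sum_lfunE linear_sum (bigD1 k) //= big1 => [|l lk].
  rewrite addr0 scale_lfunE linearZ /= (nth_allpairs _ 0 0) !size_tuple //.
  rewrite pure_tensorE linearZ /= lfunE /= kE divnMDl // modnMDl.
  by rewrite divn_small // modn_small // addn0 !coord_free // !eqxx !mulr1.
have lA : (l %/ rB < rA)%N by rewrite ltn_divLR.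
have lB : (l %% rB < rB)%N by rewrite ltn_mod.
rewrite scale_lfunE linearZ /= (nth_allpairs _ 0 0) !size_tuple //.
rewrite pure_tensorE linearZ /= lfunE /=.
rewrite (coord_free (Ordinal lA) i fX) (coord_free (Ordinal lB) j fY).
have [il|] := eqVneq (Ordinal lA) i; last by rewrite mul0r mulr0.
have [jl|] := eqVneq (Ordinal lB) j; last by rewrite !mulr0.
by case/eqP: lk; apply: ord_inj; rewrite kE -il -jl /= -divn_eq.
Qed.

Lemma tensor_coord A B rA rB (X : rA.-tuple A) (Y : rB.-tuple B)
    (k : 'I_(rA * rB)) (i : 'I_rA) (j : 'I_rB) (T : tensor_space A B) :
  basis_of fullv X -> basis_of fullv Y -> k = (i * rB + j)%N :> nat ->
  coord (allpairs_tuple (@pure_tensor R A B) X Y) k T =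
  coord Y j (T (linfun (coord X i : A -> R^o))).
Proof.
move=> bX bY kE; set XY := allpairs_tuple _ _ _.
have [fX fY] := (basis_free bX, basis_free bY).
have bXY : basis_of fullv XY.
  rewrite basisEfree subvf size_tuple dimvf hom_dim dual_dim.
  rewrite -(dimvf A) -(dimvf B) (size_basis bX) (size_basis bY) leqnn !andbT.
  apply/freeP => c c0 l.
  have rB0 : (0 < rB)%N by exact: leq_ltn_trans (leq0n j) (ltn_ord j).
  have lA : (l %/ rB < rA)%N by rewrite ltn_divLR.
  have lB : (l %% rB < rB)%N by rewrite ltn_mod.
  have lE : l = (Ordinal lA * rB + Ordinal lB)%N :> nat by exact: divn_eq.
  by rewrite -(tensor_coord_sum c fX fY lE) c0 zero_lfunE linear0.
rewrite [in RHS](coord_basis bXY (memvf T)).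
by rewrite (tensor_coord_sum _ fX fY kE).
Qed.

End TensorSpaces.

(** * Global extension of vectors and tensoriality *)

Section Extension.
Context {R : realType} {n : nat} {M : smoothManifold R n}.
Context {V : framedFamily M}.
Hypothesis hV : is_vector_bundle V.

Lemma smooth_continuous (f : M -> R) : smooth_fun f -> continuous f.
Proof.
move=> sf x; set c := chart_at x.
have dx : chart_dom c x by exact: chart_atP.
have cf : {for chart c x, continuous (f \o chart_inv c : 'rV[R]_n -> R^o)}.
  exact/differentiable_continuous/(smooth_at_differentiable openT (I : setT x) sf).
have h : {for x, continuous ((f \o chart_inv c) \o chart c)}.
  by apply: continuous_comp cf; exact: chart_continuous.
have fE : {near x, (f \o chart_inv c) \o chart c =1 f}.
  have := open_nbhs_nbhs (conj (chart_dom_open c) dx).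
  by apply: filterS => y dy; rewrite /= chartK.
rewrite /continuous_at -(nbhs_singleton fE).
apply: cvg_trans h; exact: near_eq_cvg fE.
Qed.

Lemma smooth_fun_cutoff (U K : set M) (chi f : M -> R) :
  open U -> smooth_fun chi -> closed K -> K `<=` U -> (forall x, ~ K x -> chi x = 0) ->
  smooth_on U f -> smooth_fun (fun x => chi x * f x).
Proof.
move=> oU schi cK KU chiK sf; apply: smooth_on_local => x _.
have [Kx|nKx] := pselect (K x).
  exists U; first exact: KU.
  by apply: smooth_onM oU _ sf; exact: smooth_on_sub schi.
exists (~` K) => //; apply: smooth_on_eq (smooth_on_cst _ 0).
  exact: closed_openC.
by move=> y /chiK ->; rewrite mul0r.
Qed.

(** The coordinates of [v] at [x] are kept constant along a local frame, and the result is cut off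
    by a bump function. *)
Lemma section_through x (v : V x) : exists Z : section V, smooth_section Z /\ Z x = v.
Proof.
have [a dx] : exists a : frame_idx V, frame_dom a x by case: hV.
have oa := frame_dom_open hV a.
have [chi [K [schi chi1 cK Ka chiK]]] := smooth_bump oa dx.
pose s y := \sum_i coord (frame a x) i v *: tnth (frame a y) i.
have ss : smooth_section_on (frame_dom a) s.
  apply: (smooth_section_on_sum hV _ oa) => i.
  exact: (smooth_section_onZ hV oa (smooth_on_cst _ _) (frame_smooth hV i)).
exists (fun y => chi y *: s y); split; last first.
  by rewrite chi1 scale1r; exact: esym (frame_coord hV v dx).
exact: (smooth_section_cutoff hV oa schi cK Ka chiK ss).
Qed.

(* Near [x], write [Z] in a frame cut off by a bump function [chi], and use
   [Z = chi^2 Z + (1 - chi^2) Z]. *)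
Lemma tensoriality x (U : vectType R) (Phi : section V -> U) :
  (forall k Z Z', smooth_section Z -> smooth_section Z' ->
     Phi (fun y => k *: Z y + Z' y) = k *: Phi Z + Phi Z') ->
  (forall f Z, smooth_fun f -> smooth_section Z ->
     Phi (fun y => f y *: Z y) = f x *: Phi Z) ->
  forall Z, smooth_section Z -> Z x = 0 -> Phi Z = 0.
Proof.
move=> lin hom Z sZ Zx0.
have [a dx] : exists a : frame_idx V, frame_dom a x by case: hV.
have oa := frame_dom_open hV a.
have [chi [K [schi chi1 cK Ka chiK]]] := smooth_bump oa dx.
(* One factor [chi] globalises the coefficients and a second one the frame sections, whence the
   square of [chi]. *)
pose f i y := chi y * coord (frame a y) i (Z y).
pose e i : section V := fun y => chi y *: tnth (frame a y) i.
have sf i : smooth_fun (f i).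
  apply: (smooth_fun_cutoff oa schi cK Ka chiK).
  by apply: smooth_on_sub (sZ a i) => y.
have se i : smooth_section (e i).
  exact: (smooth_section_cutoff hV oa schi cK Ka chiK (frame_smooth hV i)).
pose g y := 1 - chi y * chi y.
have oT := @openT M.
have sg : smooth_fun g.
  exact: (smooth_onD oT (smooth_on_cst _ 1) (smooth_onN oT (smooth_onM oT schi schi))).
have sfe i : smooth_section (fun y => f i y *: e i y).
  exact: (smooth_section_onZ hV oT (sf i) (se i)).
have ZE : Z = (fun y => 1 *: (g y *: Z y) + \sum_i f i y *: e i y).
  apply: functional_extensionality_dep => y; rewrite scale1r scalerBl scale1r.
  have [Ky|/chiK chi0] := pselect (K y); last first.
    rewrite chi0 mul0r scale0r subr0 big1 ?addr0 // => i _.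
    by rewrite /f chi0 mul0r scale0r.
  rewrite -addrA [X in _ + X](_ : _ = 0) ?addr0 //; apply/eqP.
  rewrite addrC subr_eq0; apply/eqP.
  rewrite [in RHS](frame_coord hV (Z y) (Ka _ Ky)) scaler_sumr.
  by apply: eq_bigr => i _; rewrite !scalerA /f mulrAC.
have fx0 i : f i x = 0 by rewrite /f Zx0 linear0 mulr0.
have Phi0 : Phi (fun=> 0) = 0.
  have := hom (fun=> 0) _ (smooth_on_cst _ 0) sZ; rewrite scale0r => <-.
  by congr Phi; apply: functional_extensionality_dep => y; rewrite scale0r.
have Phisum r : Phi (fun y => \sum_(i <- r) f i y *: e i y) = 0.
  elim: r => [|i r IH].
    rewrite -[RHS]Phi0; congr Phi; apply: functional_extensionality_dep => y.
    by rewrite big_nil.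
  have ss := smooth_section_on_sum hV r oT sfe.
  have := lin 1 _ _ (sfe i) ss; rewrite IH hom //.
  rewrite fx0 scale0r scaler0 addr0 => <-.
  congr Phi; apply: functional_extensionality_dep => y.
  by rewrite big_cons scale1r.
rewrite ZE lin; [|exact: (smooth_section_onZ hV oT sg sZ)|].
  by rewrite Phisum hom // /g chi1 mulr1 subrr scale0r scaler0 addr0.
exact: (smooth_section_on_sum hV _ oT sfe).
Qed.

Lemma tensoriality_eq x (U : vectType R) (Phi : section V -> U) :
  (forall k Z Z', smooth_section Z -> smooth_section Z' ->
     Phi (fun y => k *: Z y + Z' y) = k *: Phi Z + Phi Z') ->
  (forall f Z, smooth_fun f -> smooth_section Z ->
     Phi (fun y => f y *: Z y) = f x *: Phi Z) ->
  forall Z Z', smooth_section Z -> smooth_section Z' -> Z x = Z' x -> Phi Z = Phi Z'.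
Proof.
move=> lin hom Z Z' sZ sZ' ZZ'.
have := tensoriality lin hom (Z := fun y => (-1) *: Z' y + Z y).
rewrite lin // ZZ' !scaleN1r addNr => h; apply/eqP.
rewrite -subr_eq0 addrC; apply/eqP/h => //.
have oT := @openT M.
exact: (smooth_section_onD hV oT (smooth_section_onZ hV oT (smooth_on_cst _ (-1)) sZ') sZ).
Qed.

End Extension.

(** * The operator as a section of the tensor bundle *)

Section Connection.
Context {R : realType} {n : nat} {M : smoothManifold R n}.
Context {E : framedFamily M}.
Variable A : exactCourant E.
Variable Cp : forall x, {vspace E x}.
Hypothesis hCp : generalized_metric A Cp.
Implicit Types (Z W : section E).

Let hE : is_vector_bundle E := courant_bundle A.
Let oT := @openT M.

(** The musical isomorphism of the pairing; contraction with [Z] is evaluation at its value on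
    [Z x]. *)
Definition flat_iso x : 'Hom(E x, 'Hom(E x, R^o)) :=
  linfun (fun z : E x => linfun (pairing A x z : E x -> R^o)).

Lemma flat_isoE x z : flat_iso x z = linfun (pairing A x z : E x -> R^o).
Proof.
apply: linear_linfunE => k u v; apply/lfunP => w.
by rewrite add_lfunE scale_lfunE !lfunE /= linearPl.
Qed.

Lemma flat_isoEE x z w : flat_iso x z w = pairing A x z w :> R.
Proof. by rewrite flat_isoE lfunE. Qed.

Lemma flat_iso_inj x : lker (flat_iso x) == 0%VS.
Proof.
rewrite -subv0; apply/subvP => z; rewrite memv_ker memv0 => /eqP z0; apply/eqP.
by apply: (pairing_nondegenerate (e := A)) => w; rewrite -flat_isoEE z0 zero_lfunE.
Qed.

Lemma flat_isoK x : cancel (flat_iso x) (flat_iso x)^-1%VF.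
Proof. exact: lker0_lfunK (flat_iso_inj x). Qed.

Lemma flat_isoVK x : cancel (flat_iso x)^-1%VF (flat_iso x).
Proof.
move=> al; apply: limg_lfunVK; suff -> : limg (flat_iso x) = fullv by exact: memvf.
apply/eqP; rewrite eqEdim subvf limg_dim_eq.
  by rewrite !dimvf dual_dim leqnn.

by rewrite (eqP (flat_iso_inj x)) capv0.
Qed.

(** An arbitrary choice, not linear in [v]; values of the operator depend only on the vector at [x],
    so they are unaffected. *)
Definition extension x (v : E x) : section E := projT1 (cid (section_through hE v)).

Lemma extension_smooth x v : smooth_section (@extension x v).
Proof. by have [] := projT2 (cid (section_through hE v)). Qed.

Lemma extensionE x v : @extension x v x = v.
Proof. by have [] := projT2 (cid (section_through hE v)). Qed.

Lemma metric_operator_tensorial Z Z' W x :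
  smooth_section Z -> smooth_section Z' -> smooth_section W -> Z x = Z' x ->
  metric_operator A Cp Z W x = metric_operator A Cp Z' W x.
Proof.
move=> sZ sZ' sW; apply: (tensoriality_eq hE (Phi := fun Z => metric_operator A Cp Z W x)).
- by move=> k Y Y' sY sY'; exact: metric_operator_linearl.
- by move=> f Y sf sY; exact: metric_operator_scalel.
- by [].
- by [].
Qed.

(** An element of the tensor space takes covectors, so a covector is first turned into the vector
    that represents it under the pairing. *)
Definition metric_connection (W : section E) : section (tensor_bundle E E) := fun x =>
  (linfun (fun v : E x => metric_operator A Cp (extension v) W x)
     \o (flat_iso x)^-1)%VF.

Lemma metric_connectionE Z W x : smooth_section Z -> smooth_section W ->
  conn_contraction A Z (metric_connection W) x = metric_operator A Cp Z W x.
Proof.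
move=> sZ sW; rewrite /conn_contraction -flat_isoE comp_lfunE flat_isoK.
rewrite linear_linfunE => [|k u v].
  by apply: metric_operator_tensorial (extension_smooth _) sZ sW _; rewrite extensionE.
(* Linearity in the vector: the extension of a combination and the combination of the extensions
   agree at [x]. *)
have se := @extension_smooth x.
rewrite -(metric_operator_linearl hCp k x (se u) (se v) sW).
apply: metric_operator_tensorial => //; first exact: smooth_sectionP.
by rewrite !extensionE.
Qed.

(** Every covector at [x] is the pairing with the value of a global smooth section, so identities of
    tensors reduce to identities for [D_Z]. *)
Lemma tensor_eq x (S T : tensor_bundle E E x) :
  (forall Z, smooth_section Z ->
     (S : 'Hom('Hom(E x, R^o), E x)) (flat_iso x (Z x)) =
     (T : 'Hom('Hom(E x, R^o), E x)) (flat_iso x (Z x))) -> S = T.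
Proof.
move=> h; apply/lfunP => al; rewrite -(flat_isoVK al).
by have := h _ (extension_smooth ((flat_iso x)^-1%VF al)); rewrite extensionE.
Qed.

Lemma metric_connection_flat Z W x : smooth_section Z -> smooth_section W ->
  (metric_connection W x : 'Hom('Hom(E x, R^o), E x)) (flat_iso x (Z x)) =
  metric_operator A Cp Z W x.
Proof. by move=> sZ sW; rewrite flat_isoE; exact: metric_connectionE. Qed.

Lemma metric_connection_linear k W W' x : smooth_section W -> smooth_section W' ->
  metric_connection (fun y => k *: W y + W' y) x =
  k *: metric_connection W x + metric_connection W' x.
Proof.
move=> sW sW'; apply: tensor_eq => Z sZ; rewrite add_lfunE scale_lfunE.
rewrite !metric_connection_flat //; first exact: metric_operator_linearr.
exact: smooth_sectionP.
Qed.

Lemma metric_connection_leibniz f W x : smooth_fun f -> smooth_section W ->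
  metric_connection (fun y => f y *: W y) x = f x *: metric_connection W x
    + pure_tensor (coanchor A x (differential f x)) (W x).
Proof.
move=> sf sW; apply: tensor_eq => Z sZ.
have sfW : smooth_section (fun y => f y *: W y).
  exact: (smooth_section_onZ hE oT sf sW).
rewrite add_lfunE scale_lfunE !metric_connection_flat //.
rewrite metric_operator_leibniz // pure_tensorE flat_isoEE.
by rewrite pairing_sym pairing_coanchor.
Qed.

(** In a product frame the coefficients of [D W] are coordinates of [D_z W], with [z] in the dual
    frame for the pairing. As [z] is local, the operator is applied to [chi z] and the factor [chi]
    divided out where it is nonzero. *)
Lemma smooth_metric_connection W : smooth_section W ->
  smooth_section (metric_connection W).
Proof.
move=> sW [a b] k /=; set Da := frame_dom a `&` frame_dom b.
have kab : (k < frame_rank a * frame_rank b)%N := ltn_ord k.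
have b0 : (0 < frame_rank b)%N by case: (frame_rank b) kab => //; rewrite muln0.
have kA : (k %/ frame_rank b < frame_rank a)%N by rewrite ltn_divLR.
have kB : (k %% frame_rank b < frame_rank b)%N by rewrite ltn_mod.
pose i := Ordinal kA; pose j := Ordinal kB.
have oa := frame_dom_open hE a; have ob := frame_dom_open hE b.
have oD : open Da by exact: openI.
pose al y : 'Hom(E y, R^o) := linfun (coord (frame a y) i : E y -> R^o).
pose z y := (flat_iso y)^-1%VF (al y).
have sz : smooth_section_on (frame_dom a) z.
  apply: (smooth_on_dual hE (b := pairing A) (pairing_smooth A)
    (C := fun y => fullv) (e := fun y => frame a y)) => //.
  - by move=> y dy; exact: frame_basis.
  - by move=> l; exact: frame_smooth.
  - move=> y _ u _ h; apply: (pairing_nondegenerate (e := A)) => w.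
    by rewrite pairing_sym h // memvf.
  - by move=> y _; exact: memvf.
  (* By duality [z] pairs with the frame in constants, 1 for [l = i] and 0 otherwise. *)
  - move=> l; apply: smooth_on_eq (smooth_on_cst _ (l == i)%:R) => // y dy.
    rewrite pairing_sym -flat_isoEE flat_isoVK lfunE /= (tnth_nth 0).
    by rewrite coord_free // (basis_free (frame_basis hE dy)).
have kE : k = (i * frame_rank b + j)%N :> nat by exact: divn_eq.
apply: (smooth_on_eq (f := fun y => coord (frame b y) j
    ((metric_connection W y : 'Hom('Hom(E y, R^o), E y)) (al y)))).
- by rewrite setIT.
- move=> y [[da db] _]; symmetry.
  exact: (tensor_coord _ (frame_basis hE da) (frame_basis hE db) kE).
apply: smooth_on_local => x [[da db] _].
have [chi [K [schi chi1 cK Ka chiK]]] := smooth_bump oD (conj da db).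
pose U := Da `&` [set y | chi y != 0].
have oU : open U.
  apply: openI => //; apply: (@open_comp _ _ chi [set r | r != 0]).
    by move=> y _; exact: smooth_continuous.
  exact: open_neq.
exists U; first by split => //=; rewrite chi1 oner_eq0.
have szD : smooth_section_on Da z by apply: smooth_section_on_sub sz => y [].
have sZ : smooth_section (fun y => chi y *: z y).
  exact: (smooth_section_cutoff hE oD schi cK Ka chiK szD).
have sM := smooth_metric_operator hCp sZ sW.
have sMj : smooth_on U (fun y => coord (frame b y) j
    (metric_operator A Cp (fun y => chi y *: z y) W y)).
  by apply: smooth_on_sub (sM b j) => y [[]].
have schiV : smooth_on U (fun y => (chi y)^-1).
  apply: smooth_onV => // [y []//|]; exact: smooth_on_sub schi.
have := smooth_onM oU schiV sMj.
apply: smooth_on_eq => // y [_ chi0].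
rewrite -(metric_connection_flat y sZ sW) linearZ /= flat_isoVK !linearZ /=.
by rewrite mulKf.
Qed.

End Connection.

Theorem theorem3p1 (R : realType) (n : nat) (M : smoothManifold R n)
    (E : framedFamily M) (A : exactCourant E)
    (Cp : forall x : M, {vspace E x}) (hCp : generalized_metric A Cp) :
  exists D : section E -> section (tensor_bundle E E),
    [/\ generalized_connection A D,
        forall Z W : section E,
          smooth_section Z -> smooth_section W ->
          forall x : M, conn_contraction A Z (D W) x = metric_operator A Cp Z W x,
        preserves A D (fun x : M => pairing A x) &
        preserves A D (Gmetric A Cp)].
Proof.
exists (metric_connection A Cp); split.
- split.
  + by move=> s ss; exact: smooth_metric_connection.
  + by move=> k s t ss st x; exact: metric_connection_linear.
  (* The commutator of [D] with [f] is the pure tensor with the differential of [f], which is linear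
     over functions and so commutes with [g]. *)
  + move=> f g s sf sg ss x.
    have sgs : smooth_section (fun y => g y *: s y).
      exact: (smooth_section_onZ (courant_bundle A) (@openT M) sg ss).
    rewrite (metric_connection_leibniz hCp x sf sgs) (metric_connection_leibniz hCp x sf ss).
    have addKl (u v : tensor_bundle E E x) : u + v - u = v by rewrite addrAC subrr add0r.
    rewrite !addKl.
    apply/lfunP => al; rewrite add_lfunE opp_lfunE scale_lfunE zero_lfunE.
    by rewrite !pure_tensorE !scalerA mulrC subrr.
  + by move=> f s sf ss x; exact: metric_connection_leibniz.
- by move=> Z W sZ sW x; exact: metric_connectionE.
- by move=> Z s t sZ ss st x; rewrite !metric_connectionE //; exact: metric_operator_pairing.
- by move=> Z s t sZ ss st x; rewrite !metric_connectionE //; exact: metric_operator_metric.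
Qed.
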